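(* Let $A\in\mathbb{R}^{n\times n}$, $B\in\mathbb{R}^{n\times m}$, $C\in\mathbb{R}^{m\times n}$, $D\in\mathbb{R}^{m\times m}$ be such that $\mathcal M=\{A,B,C,D\}$ is a minimal state-space realization of a strictly passive transfer function $Z(s)=C(sI_n-A)^{-1}B+D$ of McMillan degree $n$. For real $\xi$ let $Z_\xi(s):=Z(s-\tfrac{\xi}{2})-\tfrac{\xi}{2}I_m$, with model $\{A+\tfrac{\xi}{2}I_n,B,C,D-\tfrac{\xi}{2}I_m\}$, and let $$\Xi:=\sup_\xi\{\xi : Z_\xi(s)\text{ is strictly passive}\}.$$ For any $\xi\in(0,\Xi)$ consider an $\hat n$-dimensional deflating subspace, with basis $\begin{bmatrix} U_\xi \\ V_\xi \\ W_\xi \end{bmatrix}$ ($U_\xi,V_\xi\in\mathbb{R}^{n\times\hat n}$, $W_\xi\in\mathbb{R}^{m\times\hat n}$), of the shifted pencil below, corresponding to the spectrum of a real matrix $R_\xi\in\mathbb{R}^{\hat n\times\hat n}$ with all eigenvalues in the open right half plane; that is, identically in $s$, $$\begin{bmatrix} 0 & A+\frac{\xi}{2}I_n-sI_n & B \\ A^{\mathsf T}+\frac{\xi}{2}I_n+sI_n & 0 & C^{\mathsf T} \\ B^{\mathsf T} & C & D^{\mathsf T}+D-\xi I_m \end{bmatrix}\begin{bmatrix} U_\xi \\ V_\xi \\ W_\xi \end{bmatrix}=\begin{bmatrix} V_\xi \\ -U_\xi \\ 0 \end{bmatrix}(R_\xi-sI_{\hat n}).$$ Then: (1) $U_\xi$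 and $V_\xi$ have full column rank $\hat n$, and $\hat X_\xi:=-U_\xi^{\mathsf T}V_\xi$ is symmetric and positive definite. (2) The low order transfer function $\hat Z(s)=\hat C(sI_{\hat n}-\hat A)^{-1}\hat B+\hat D$ with model parameters $$\hat{\mathcal M}=\{\hat A,\hat B,\hat C,\hat D\}:=\{(U_\xi^{\mathsf T}V_\xi)^{-1}U_\xi^{\mathsf T}AV_\xi,\ (U_\xi^{\mathsf T}V_\xi)^{-1}U_\xi^{\mathsf T}B,\ CV_\xi,\ D\}$$ satisfies the interpolation conditions $Z(\infty)=\hat Z(\infty)=D$ and, for $j=1,\dots,\hat n$, $$Z(\sigma_j-\xi/2)W_\xi r_j=\hat Z(\sigma_j-\xi/2)W_\xi r_j,\qquad r_j^{\mathsf T}W_\xi^{\mathsf T}Z(-\sigma_j-\xi/2)=r_j^{\mathsf T}W_\xi^{\mathsf T}\hat Z(-\sigma_j-\xi/2),$$ where $(\sigma_j,r_j)$, $j=1,\dots,\hat n$, are self-conjugate (eigenvalue, eigenvector) pairs of $R_\xi$. (3) $\hat X_\xi$ is a certificate for the linear matrix inequality $$\begin{bmatrix} -\hat X_\xi\hat A-\hat A^{\mathsf T}\hat X_\xi & \hat C^{\mathsf T}-\hat X_\xi\hat B \\ \hat C-\hat B^{\mathsf T}\hat X_\xi & \hat D^{\mathsf T}+\hat D \end{bmatrix}\succeq\xi\begin{bmatrix} \hat X_\xi & 0 \\ 0 & I_m \end{bmatrix}\succ0 .$$ (4) $\xi/2$ is a lower bound for the passivity radius of the normalized port-Hamiltonian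 realization $\{\hat J-\hat R,\ \hat G-\hat P,\ (\hat G+\hat P)^{\mathsf T},\ \hat N+\hat S\}$ obtained, using a factorization $\hat X_\xi=T_\xi^{\mathsf T}T_\xi$, via the state-space transformation $$\begin{bmatrix} T_\xi & 0 \\ 0 & I_m \end{bmatrix}\begin{bmatrix} \hat A & \hat B \\ \hat C & \hat D \end{bmatrix}\begin{bmatrix} T_\xi^{-1} & 0 \\ 0 & I_m \end{bmatrix}=\begin{bmatrix} \hat J-\hat R & \hat G-\hat P \\ (\hat G+\hat P)^{\mathsf T} & \hat N+\hat S \end{bmatrix}.$$
   Context: For a rational $m\times m$ matrix $Z(s)$ with real coefficients put $\Phi(s):=Z^{\mathsf T}(-s)+Z(s)$. $Z(s)$ is positive real if $\Phi(\imath\omega)\succeq0$ for all $\omega\in\mathbb{R}$ and strictly positive real if $\Phi(\imath\omega)\succ0$ for all $\omega\in\mathbb{R}$. A transfer function given by a realization $\{A,B,C,D\}$ is asymptotically stable if all eigenvalues of $A$ lie in the open left half plane, and stable if they lie in the closed left half plane with those on the imaginary axis semi-simple. It is strictly passive if it is strictly positive real and asymptotically stable; it is passive if it is positive real and stable, with Hermitian positive semidefinite residue at every pole on the imaginary axis. Standing convention: for a strictly passive $Z$, positivity of $\Phi(\imath\omega)$ is understood to hold also at $\omega=\infty$, so that $D+D^{\mathsf T}\succ0$ (and correspondingly $D+D^{\mathsf T}-\xi I_m\succ0$ for strictly passive $Z_\xi$). Minimal means controllable and observable. ''Self-conjugate'' means that non-real pairs $(\sigma_j,r_j)$ occur together with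 their complex conjugates; $\mathsf T$ is the transpose without conjugation. In a normalized port-Hamiltonian realization $\{J-R,\ G-P,\ (G+P)^{\mathsf T},\ N+S\}$ the matrices satisfy $J=-J^{\mathsf T}$, $N=-N^{\mathsf T}$, and $\begin{bmatrix} R & P \\ P^{\mathsf T} & S \end{bmatrix}$ is symmetric positive semidefinite. The passivity radius of a passive model $\{A,B,C,D\}$ is the size of the smallest perturbation $\Delta=\begin{bmatrix} \Delta_A & \Delta_B \\ \Delta_C & \Delta_D \end{bmatrix}$ (measured by the spectral norm or the Frobenius norm) that can make the model $\{A+\Delta_A,B+\Delta_B,C+\Delta_C,D+\Delta_D\}$ lose its passivity.
   Formalization: The left interpolation condition at −σ_j−ξ/2 is claimed only when neither A nor Â has −σ_j−ξ/2 as an eigenvalue; otherwise Z or Ẑ is undefined there by its formula, and the equality can fail (Z_ξ(s)=1+(s−1)/(s²+2s+2), σ=1). *)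

(* Defs.v *)
(* MathComp-Analysis, with the complex numbers R[i] of mathcomp-real-closed. *)
From HB Require Import structures.
From mathcomp Require Export all_boot all_order all_algebra.
From mathcomp Require Export all_classical all_reals all_analysis.
From mathcomp Require Export complex.

Set Implicit Arguments.
Unset Strict Implicit.
Unset Printing Implicit Defensive.

Import Order.TTheory GRing.Theory Num.Theory numFieldNormedType.Exports.
Local Open Scope classical_set_scope.
Local Open Scope ring_scope.
Local Open Scope complex_scope.

Section Definiteness.
Variable R : realType.

Definition psdmx k (M : 'M[R]_k) : Prop :=
  M^T = M /\ forall v : 'cV[R]_k, 0 <= (v^T *m M *m v) 0 0.

Definition pdmx k (M : 'M[R]_k) : Prop :=
  M^T = M /\ forall v : 'cV[R]_k, v != 0 -> 0 < (v^T *m M *m v) 0 0.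

(* On R[i], 0 <= z and 0 < z include that z is real. *)
Definition hpsdmx k (M : 'M[R[i]]_k) : Prop :=
  (M ^t*)%sesqui = M /\
  forall v : 'cV[R[i]]_k, 0 <= ((v ^t*)%sesqui *m M *m v) 0 0.

Definition hpdmx k (M : 'M[R[i]]_k) : Prop :=
  (M ^t*)%sesqui = M /\
  forall v : 'cV[R[i]]_k, v != 0 -> 0 < ((v ^t*)%sesqui *m M *m v) 0 0.

Definition cmx k l (M : 'M[R]_(k, l)) : 'M[R[i]]_(k, l) :=
  map_mx (real_complex R) M.

Definition frobenius_norm k l (M : 'M[R]_(k, l)) : R :=
  Num.sqrt (\sum_i \sum_j M i j ^+ 2).

(* The operator norm induced by the Euclidean norm; the latter is
   [frobenius_norm] on column vectors. *)
Definition spectral_norm k l (M : 'M[R]_(k, l)) : R :=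
  sup [set frobenius_norm (M *m v) | v in
        [set v : 'cV[R]_l | frobenius_norm v <= 1]].

End Definiteness.

Record model (R : Type) (n m : nat) := Model {
  mA : 'M[R]_n; mB : 'M[R]_(n, m); mC : 'M[R]_(m, n); mD : 'M[R]_m }.

Section Models.
Variable R : realType.

Section Fixed.
Variables n m : nat.
Implicit Types (M : model R n m) (s : R[i]) (w xi : R).

Definition controllable M : Prop :=
  \rank (\mxrow_(k < n) (mA M ^+ k *m mB M)) = n.

Definition observable M : Prop :=
  \rank (\mxcol_(k < n) (mC M *m mA M ^+ k)) = n.

Definition minimal M : Prop := controllable M /\ observable M.

Definition regular_at M s : Prop := s%:M - cmx (mA M) \in unitmx.

(* [tf M s] is meaningful only when [regular_at M s]. *)
Definition tf M s : 'M[R[i]]_m :=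
  cmx (mC M) *m invmx (s%:M - cmx (mA M)) *m cmx (mB M) + cmx (mD M).

(* The value at infinity, read in the chart t = 1/s, is the real matrix K. *)
Definition tf_at_infty M (K : 'M[R]_m) : Prop :=
  forall i j, (fun t : R[i]^o => tf M t^-1 i j : R[i]^o) @ (0 : R[i]^o)^' -->
              (cmx K i j : R[i]^o).

Definition Phi M s : 'M[R[i]]_m := (tf M (- s))^T + tf M s.

(* As A is real, +iw and -iw are regular simultaneously. *)
Definition positive_real M : Prop :=
  forall w, regular_at M (0 +i* w) -> hpsdmx (Phi M (0 +i* w)).

Definition strictly_positive_real M : Prop :=
  forall w, regular_at M (0 +i* w) -> hpdmx (Phi M (0 +i* w)).

Definition asymptotically_stable M : Prop :=
  forall s, eigenvalue (cmx (mA M)) s -> complex.Re s < 0.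

(* Semi-simple: geometric and algebraic multiplicities agree. *)
Definition stable M : Prop :=
  forall s, eigenvalue (cmx (mA M)) s ->
    complex.Re s <= 0 /\
    (complex.Re s = 0 ->
     \rank (eigenspace (cmx (mA M)) s) = mup s (char_poly (cmx (mA M)))).

(* The residue at a pole that is at most simple; [stable] guarantees this for
   every pole on the imaginary axis. *)
Definition residue M s (K : 'M[R[i]]_m) : Prop :=
  forall i j, (fun t : R[i]^o => (t - s) * tf M t i j : R[i]^o) @
                (s : R[i]^o)^' --> (K i j : R[i]^o).

(* Poles are eigenvalues of A; an eigenvalue that is not a pole has residue 0,
   so asking the residue condition at all eigenvalues is harmless. *)
Definition passive M : Prop :=
  [/\ positive_real M, stable M &
      forall w, eigenvalue (cmx (mA M)) (0 +i* w) ->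
        exists2 K, residue M (0 +i* w) K & hpsdmx K].

(* The last conjunct is positivity of Phi at infinity. *)
Definition strictly_passive M : Prop :=
  [/\ strictly_positive_real M, asymptotically_stable M &
      pdmx ((mD M)^T + mD M)].

(* The model of Z_xi; see [tf_shift]. *)
Definition shift xi M : model R n m :=
  Model (mA M + (xi / 2)%:M) (mB M) (mC M) (mD M - (xi / 2)%:M).

Lemma tf_shift xi M s :
  tf (shift xi M) s = tf M (s - (xi / 2)%:C) - ((xi / 2)%:C)%:M.
Proof.
rewrite /tf /shift /cmx /= map_mxD map_mxB !map_scalar_mx /=.
by rewrite [in RHS]raddfB /= addrA opprD [- _ - _]addrC addrA.
Qed.

Definition Xi_sup M : \bar R :=
  ereal_sup [set xi%:E | xi in [set xi | strictly_passive (shift xi M)]].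

Definition shifted_pencil M xi (s : R) : 'M[R]_(n + (n + m)) :=
  block_mx
    0
    (row_mx (mA M + (xi / 2)%:M - s%:M) (mB M))
    (col_mx ((mA M)^T + (xi / 2)%:M + s%:M) (mB M)^T)
    (block_mx 0 (mC M)^T
              (mC M) ((mD M)^T + mD M - xi%:M)).

Definition perturb M (Delta : 'M[R]_(n + m)) : model R n m :=
  Model (mA M + ulsubmx Delta) (mB M + ursubmx Delta)
        (mC M + dlsubmx Delta) (mD M + drsubmx Delta).

(* "Smallest" is read as the infimum; it is +oo if no perturbation destroys
   passivity. *)
Definition passivity_radius (nrm : 'M[R]_(n + m) -> R) M : \bar R :=
  ereal_inf [set (nrm Delta)%:E | Delta in
              [set Delta | ~ passive (perturb M Delta)]].

Definition normalized_pH (J Rm : 'M[R]_n) (G P : 'M[R]_(n, m))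
    (N S : 'M[R]_m) : Prop :=
  [/\ J^T = - J, N^T = - N & psdmx (block_mx Rm P P^T S)].

End Fixed.

Definition eigenpair k (M : 'M[R]_k) (sigma : R[i]) (r : 'cV[R[i]]_k) : Prop :=
  r != 0 /\ cmx M *m r = sigma *: r.

(* Real pairs are their own conjugates, so only non-real ones are
   constrained. *)
Definition self_conjugate k l (sigma : 'I_l -> R[i])
    (r : 'I_l -> 'cV[R[i]]_k) : Prop :=
  forall j, exists j', sigma j' = (sigma j)^* /\ r j' = map_mx conjc (r j).

End Models.

(* Main.v *)
(* Let xi' > xi be such that Z_xi' is still strictly passive.  The Hamiltonian
   matrix of Z_xi' then has no imaginary eigenvalue, so the whole space splits
   into an antistable and a stable invariant subspace [V; U].  Controllability
   makes V injective on both, hence both have dimension n, and P = - U V^-1,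
   taken on the antistable one, is a positive definite solution of the Lur'e
   equations of Z_xi'.  For the given deflating subspace at xi, the matrix
   X - V^T P V solves a Lyapunov equation with antistable coefficient and
   positive semidefinite right-hand side, so that X >= V^T P V > 0.  The
   difference of both sides of the reduced matrix inequality is the Gram matrix
   [W, -1]^T (D^T + D - xi) [W, -1].  In normalized coordinates that inequality
   says that the port-Hamiltonian matrix dominates xi/2 times the identity,
   which a perturbation of norm less than xi/2 cannot destroy. *)
From mathcomp Require Import ring lra.
Require Import Defs.

Set Implicit Arguments.
Unset Strict Implicit.
Unset Printing Implicit Defensive.

Import Order.TTheory GRing.Theory Num.Theory numFieldNormedType.Exports.
Local Open Scope ring_scope.

Local Notation "M ^H" := (map_mx Num.conj (trmx M))
  (at level 8, format "M ^H") : ring_scope.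

(** When nh < n the basis does not determine a Riccati solution, since V has no inverse; the
    positivity of X has to be borrowed from the full n-dimensional problem. That problem is posed at
    xi' because the supremum Xi only provides strict passivity at some level above xi. The gap xi' -
    xi enters the estimates with a favourable sign, so P need not solve an equation at xi itself.
    The existence of P is the algebraic half of the positive real lemma. Semidefiniteness of
    Lyapunov solutions is obtained by Schur triangularization instead of an integral of matrix
    exponentials. Eigenvectors and Schur forms call for complex matrices, so the pencil is embedded
    by [cmx] and the definiteness of X is brought back to the reals at the end. *)

Lemma addmxE (V : nmodType) m n (M N : 'M[V]_(m, n)) i j :
  (M + N) i j = M i j + N i j.
Proof. by rewrite mxE. Qed.

Lemma oppmxE (V : zmodType) m n (M : 'M[V]_(m, n)) i j : (- M) i j = - M i j.
Proof. by rewrite mxE. Qed.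

Lemma scalemxE (V : pzRingType) m n a (M : 'M[V]_(m, n)) i j :
  (a *: M) i j = a * M i j.
Proof. by rewrite mxE. Qed.

Definition mxlinE := (addmxE, oppmxE, scalemxE).

(** * Hermitian transposes *)

Section Adjoint.
Variable C : numClosedFieldType.

Lemma adjmxK m n (M : 'M[C]_(m, n)) : (M^H)^H = M.
Proof. exact: trmxCK. Qed.

Lemma adjmxM m n p (M : 'M[C]_(m, n)) (N : 'M[C]_(n, p)) :
  (M *m N)^H = N^H *m M^H.
Proof. by rewrite trmx_mul map_mxM. Qed.

Lemma adjmxD m n (M N : 'M[C]_(m, n)) : (M + N)^H = M^H + N^H.
Proof. by rewrite !linearD /= map_mxD. Qed.

Lemma adjmxN m n (M : 'M[C]_(m, n)) : (- M)^H = - M^H.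
Proof. by rewrite !linearN /= map_mxN. Qed.

Lemma adjmxZ m n a (M : 'M[C]_(m, n)) : (a *: M)^H = a^* *: M^H.
Proof. by rewrite !linearZ /= map_mxZ. Qed.

Lemma adjmx0 m n : (0 : 'M[C]_(m, n))^H = 0.
Proof. by rewrite trmx0 map_mx0. Qed.

Lemma adjmx_scalar n (a : C) : (a%:M : 'M[C]_n)^H = (a^*)%:M.
Proof. by rewrite tr_scalar_mx map_scalar_mx. Qed.

Lemma adjmx1 n : (1%:M : 'M[C]_n)^H = 1%:M.
Proof. by rewrite adjmx_scalar rmorph1. Qed.

Lemma adj_block_mx m1 m2 n1 n2 (M : 'M[C]_(m1, n1)) N P (Q : 'M[C]_(m2, n2)) :
  (block_mx M N P Q)^H = block_mx M^H P^H N^H Q^H.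
Proof. by rewrite tr_block_mx map_block_mx. Qed.

Lemma adj_col_mx m1 m2 n (M : 'M[C]_(m1, n)) (N : 'M[C]_(m2, n)) :
  (col_mx M N)^H = row_mx M^H N^H.
Proof. by rewrite tr_col_mx map_row_mx. Qed.

Lemma adj_row_mx m n1 n2 (M : 'M[C]_(m, n1)) (N : 'M[C]_(m, n2)) :
  (row_mx M N)^H = col_mx M^H N^H.
Proof. by rewrite tr_row_mx map_col_mx. Qed.

Lemma sqnorm_ge0 n (v : 'cV[C]_n) : 0 <= (v^H *m v) 0 0.
Proof.
rewrite mxE sumr_ge0 // => i _; rewrite !mxE mulrC.
exact: mul_conjC_ge0.
Qed.

Lemma sqnorm_eq0 n (v : 'cV[C]_n) : ((v^H *m v) 0 0 == 0) = (v == 0).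
Proof.
apply/eqP/eqP => [|->]; last by rewrite mulmx0 mxE.
rewrite mxE => /eqP; rewrite psumr_eq0 => [/allP h|i _]; last first.
  by rewrite !mxE mulrC mul_conjC_ge0.
apply/colP => i; have := h i (mem_index_enum i).
by rewrite !mxE /= mulrC mul_conjC_eq0 => /eqP.
Qed.

Lemma adj_mx11 (M : 'M[C]_1) : (M^H) 0 0 = (M 0 0)^*.
Proof. by rewrite !mxE. Qed.

Lemma eigenvalue_trmx n (M : 'M[C]_n) a : eigenvalue M^T a = eigenvalue M a.
Proof.
rewrite !eigenvalue_root_char; congr (root _ a).
rewrite /char_poly /char_poly_mx -[in LHS]det_tr linearB /= -map_trmx trmxK.
by rewrite tr_scalar_mx.
Qed.

(** [eigenvalue] is defined through row vectors, whereas states and basis matrices are columns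
    here. *)
Lemma eigenvalue_colP n (M : 'M[C]_n) a :
  reflect (exists2 v : 'cV_n, M *m v = a *: v & v != 0) (eigenvalue M a).
Proof.
rewrite -eigenvalue_trmx; apply: (iffP eigenvalueP) => -[v Mv v0].
  exists v^T; last by rewrite trmx_eq0.
  by rewrite -[M]trmxK -trmx_mul Mv linearZ.
exists v^T; last by rewrite trmx_eq0.
by rewrite -trmx_mul Mv linearZ.
Qed.

Lemma eigenvalue_unitmx n (M : 'M[C]_n) a :
  (a%:M - M \in unitmx) = ~~ eigenvalue M a.
Proof.
rewrite /eigenvalue kermx_eq0 negbK row_free_unit -opprB.
by rewrite -scaleN1r unitmxZ ?unitrN1.
Qed.

End Adjoint.

(** * Semidefinite matrices *)

Section Semidefinite.
Variable R : realType.
Local Notation C := R[i].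

Lemma hpsdmx_congr k l (T : 'M[C]_(k, l)) (M : 'M[C]_k) :
  hpsdmx M -> hpsdmx (T^H *m M *m T).
Proof.
move=> [MH M0]; split=> [|v].
  by rewrite !adjmxM adjmxK mulmxA; congr (_ *m _ *m _).
by have := M0 (T *m v); rewrite adjmxM !mulmxA.
Qed.

Lemma hpsdmxD k (M N : 'M[C]_k) : hpsdmx M -> hpsdmx N -> hpsdmx (M + N).
Proof.
move=> [MH M0] [NH N0]; split=> [|v].
  by rewrite adjmxD; congr (_ + _).
by rewrite mulmxDr mulmxDl mxE addr_ge0.
Qed.

Lemma hpsdmxZ k a (M : 'M[C]_k) : 0 <= a -> hpsdmx M -> hpsdmx (a *: M).
Proof.
move=> a0 [MH M0]; split=> [|v].
  by rewrite adjmxZ geC0_conj //; congr (_ *: _).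
by rewrite -scalemxAr -scalemxAl mxE mulr_ge0.
Qed.

Lemma hpsdmx1 k : hpsdmx (1%:M : 'M[C]_k).
Proof. by split=> [|v]; rewrite ?adjmx1 // mulmx1 sqnorm_ge0. Qed.

Lemma hpsdmx_gram k l (T : 'M[C]_(k, l)) : hpsdmx (T^H *m T).
Proof. by rewrite -[T^H]mulmx1; apply/hpsdmx_congr/hpsdmx1. Qed.

Lemma hpdmx_psd k (M : 'M[C]_k) : hpdmx M -> hpsdmx M.
Proof.
move=> [MH M0]; split=> // v; have [->|/M0/ltW//] := eqVneq v 0.
by rewrite mulmx0 mxE.
Qed.

Lemma hpdmx_ker k (M : 'M[C]_k) (v : 'cV[C]_k) :
  hpdmx M -> v^H *m M *m v = 0 -> v = 0.
Proof.
move=> [_ M0] v0; apply/eqP/negPn/negP => /M0.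
by rewrite v0 mxE ltxx.
Qed.

(* Perturbing v to v - e M v for a small real e > 0 would make the form
   negative. *)
Lemma hpsdmx_ker k (M : 'M[C]_k) (v : 'cV[C]_k) :
  hpsdmx M -> (v^H *m M *m v) 0 0 = 0 -> M *m v = 0.
Proof.
move=> [MH M0] v0; have [w wD] : {w | M *m v = w} by exists (M *m v).
have wE : v^H *m M = w^H by rewrite -wD adjmxM; congr (_ *m _).
rewrite wD; set a := (w^H *m w) 0 0; set b := (w^H *m M *m w) 0 0.
have a0 : 0 <= a := sqnorm_ge0 w.
have b0 : 0 <= b := M0 w.
apply/eqP; rewrite -sqnorm_eq0 -/a; apply/eqP/le_anti; rewrite a0 andbT.
(* The form at v - e w equals e (e b - 2 a). This [e] makes e b at most a, and the summand 1 keeps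
   the denominator positive when b is 0. *)
pose e := a / (1 + b).
have b1 : 0 < 1 + b by rewrite ltr_wpDr.
have e0 : 0 <= e by rewrite divr_ge0 // ltW.
have vw : (v^H *m w) 0 0 = 0 by rewrite -wD mulmxA.
have := M0 (v - e *: w).
rewrite adjmxD adjmxN adjmxZ geC0_conj //.
rewrite !(mulmxDl, mulmxDr, mulmxN, mulNmx) -!scalemxAl -!scalemxAr.
rewrite -[v^H *m M *m v]mulmxA -[w^H *m M *m v]mulmxA wD wE.
rewrite !mxlinE vw -/a -/b.
match goal with |- is_true (0 <= ?x) -> _ =>
  have -> : x = e * (e * b - 2 * a) by ring end.
have [->|a1] := eqVneq a 0; first by rewrite lexx.
have e1 : 0 < e by rewrite divr_gt0 // lt_def a1.
rewrite pmulr_rge0 // subr_ge0 => h.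
have : e * b <= a.
  by rewrite /e mulrAC ler_pdivrMr // mulrDr mulr1 lerDr.
by move=> /(le_trans h); rewrite mulr_natl mulr2n gerDl.
Qed.

End Semidefinite.

(** * The Lyapunov inequality *)

Section Lyapunov.
Variable R : realType.
Local Notation C := R[i].

Lemma hpsdmx_block_diag k l (M : 'M[C]_k) (N : 'M[C]_l) :
  hpsdmx M -> hpsdmx N -> hpsdmx (block_mx M 0 0 N).
Proof.
move=> [MH M0] [NH N0]; split=> [|v].
  by rewrite adj_block_mx !adjmx0; congr block_mx.
rewrite -[v]vsubmxK adj_col_mx mul_row_block mul_row_col !mulmx0 addr0 add0r.
by rewrite mxE addr_ge0.
Qed.

Lemma hpsdmx_ulsub k l (M : 'M[C]_(k + l)) : hpsdmx M -> hpsdmx (ulsubmx M).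
Proof.
move=> /(@hpsdmx_congr _ _ _ (col_mx 1%:M 0)).
rewrite -{1}[M]submxK adj_col_mx adjmx1 adjmx0.
rewrite mul_row_block mul_row_col !mul1mx !mul0mx !addr0 mulmx0 addr0 mulmx1.
by [].
Qed.

Lemma mul_mx11 (M N : 'M[C]_1) : (M *m N) 0 0 = M 0 0 * N 0 0.
Proof. by rewrite mxE big_ord1. Qed.

Lemma hpsdmx11 (M : 'M[C]_1) : 0 <= M 0 0 -> hpsdmx M.
Proof.
move=> M0; split=> [|v].
  by apply/matrixP => i j; rewrite !ord1 adj_mx11 geC0_conj.
by rewrite !mul_mx11 !mxE mulrAC mulrC mulr_ge0 // mulrC mul_conjC_ge0.
Qed.

(* The Schur complement of the pivot dE: the multiplier t exists even when dE
   vanishes, since then d vanishes too. *)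
Lemma lyapunov_block k (a dE : 'M[C]_1) (b : 'M[C]_(k, 1)) (d : 'M[C]_(1, k))
    (L E : 'M[C]_k) :
  0 < a 0 0 + (a 0 0)^* -> ((a 0 0)^*%:M + L) \in unitmx ->
  (forall F, F^H = F -> hpsdmx (L *m F + F *m L^H) -> hpsdmx F) ->
  dE^H = dE -> E^H = E ->
  hpsdmx (block_mx a 0 b L *m block_mx dE d d^H E +
          block_mx dE d d^H E *m (block_mx a 0 b L)^H) ->
  hpsdmx (block_mx dE d d^H E).
Proof.
move=> a0 aLu IH dEH EH Qpsd.
have Q11 := hpsdmx_ulsub Qpsd; have Qker := hpsdmx_ker Qpsd.
move: Q11 Qker; rewrite adj_block_mx adjmx0 !mulmx_block !mul0mx !mulmx0 !addr0.
rewrite add_block_mx block_mxKul => Q11 Qker.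
have dEr : (dE 0 0)^* = dE 0 0 by rewrite -adj_mx11 dEH.
have q11 : (a *m dE + dE *m a^H) 0 0 = dE 0 0 * (a 0 0 + (a 0 0)^*).
  by rewrite mxlinE !mul_mx11 adj_mx11; ring.
have dE0 : 0 <= dE 0 0.
  have := Q11.2 1%:M; rewrite adjmx1 mul1mx mulmx1 q11.
  by rewrite pmulr_lge0.
have [t tE] : exists t : 'M[C]_(k, 1), d^H = - (t *m dE).
  have [dEz|dEnz] := eqVneq (dE 0 0) 0; last first.
    exists (- (dE 0 0)^-1 *: d^H).
    rewrite scaleNr mulNmx opprK -scalemxAl [dE]mx11_scalar mul_mx_scalar.
    by rewrite mxE eqxx mulr1n scalerA mulVf // scale1r.
  (* With a vanishing pivot the first basis vector is isotropic for the semidefinite right-hand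
     side, hence in its kernel. The lower left block then reads L d^H + conj(a) d^H = 0, and L +
     conj(a) is invertible. *)
  exists 0; rewrite mul0mx oppr0.
  have dEz' : dE = 0 by rewrite [dE]mx11_scalar dEz raddf0.
  have := Qker (col_mx 1%:M 0).
  rewrite adj_col_mx adjmx1 adjmx0 -mulmxA !mul_block_col !mul_row_col.
  rewrite !mulmx0 !mulmx1 !mul1mx !mul0mx !addr0 q11 dEz mul0r.
  move=> /(_ erefl); rewrite dEz' !mulmx0 !mul0mx !add0r => /eqP.
  rewrite col_mx_eq0 => /andP[_ /eqP].
  rewrite [a]mx11_scalar adjmx_scalar mul_mx_scalar -mul_scalar_mx addrC.
  by rewrite -mulmxDl => h; rewrite -[LHS](mulKmx aLu) h mulmx0.
have dD : d = - (dE *m t^H).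
  by rewrite -[d]adjmxK tE adjmxN adjmxM dEH.
pose F := E - t *m dE *m t^H.
have -> : block_mx dE d d^H E =
    ((block_mx 1%:M 0 (- t) 1%:M)^H)^H *m block_mx dE 0 0 F *m
     (block_mx 1%:M 0 (- t) 1%:M)^H.
  rewrite adjmxK adj_block_mx adjmx0 !adjmx1 adjmxN !mulmx_block.
  rewrite !mul0mx !mulmx0 !mulmx1 !mul1mx !(addr0, add0r) mulmxN !mulNmx.
  rewrite mulmxN opprK /F addrC subrK -dD.
  by congr block_mx.
apply/hpsdmx_congr/hpsdmx_block_diag; first exact: hpsdmx11.
have FH : F^H = F.
  by rewrite /F adjmxD adjmxN !adjmxM adjmxK dEH EH mulmxA.
apply: IH => //.
(* The row [t, 1] annihilates the first block column of the unknown, so compressing the right-hand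
   side by it leaves L F + F L^H, as [IH] requires. *)
have := hpsdmx_congr (row_mx t 1%:M)^H Qpsd.
have tQ : row_mx t 1%:M *m block_mx dE d d^H E = row_mx 0 F.
  rewrite mul_row_block !mul1mx tE subrr; congr row_mx.
  by rewrite dD mulmxN mulmxA addrC.
have Qt : block_mx dE d d^H E *m (row_mx t 1%:M)^H = col_mx 0 F.
  have /(congr1 (fun M => M^H)) := tQ.
  by rewrite adjmxM (adj_row_mx 0) adj_block_mx adjmxK dEH EH FH adjmx0.
rewrite adjmxK mulmxDr mulmxDl !mulmxA tQ.
rewrite -[X in hpsdmx (X + _)]mulmxA Qt.
rewrite mul_row_block -mulmxA -adjmxM mul_row_block !mul1mx !mulmx0 add0r.
by rewrite adj_row_mx !mul_row_col !(mulmx0, mul0mx) !add0r.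
Qed.

Lemma trigmx_unit k (L : 'M[C]_k) :
  is_trig_mx L -> (L \in unitmx) = [forall i, L i i != 0].
Proof.
move=> Ltrig; rewrite unitmxE det_trig // unitfE.
by apply/prodf_neq0/forallP => h i; [apply: h | move=> _; apply: h].
Qed.

Lemma is_trig_scalarD k a (L : 'M[C]_k) :
  is_trig_mx L -> is_trig_mx (a%:M + L).
Proof.
move=> /is_trig_mxP L0; apply/is_trig_mxP => i j ij.
by rewrite mxlinE L0 // mxE addr0 (negPf (_ : i != j)) // neq_ltn ij.
Qed.

(** Induction on the size: [lyapunov_block] splits off the first row and column, and the trailing
    block stays triangular with the same sign condition on its diagonal. *)
Lemma lyapunov_trig k (L E : 'M[C]_k) :
  is_trig_mx L -> (forall i, 0 < L i i + (L i i)^*) -> E^H = E ->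
  hpsdmx (L *m E + E *m L^H) -> hpsdmx E.
Proof.
elim: k L E => [|k IH] L E.
  by move=> _ _ _ _; split=> [|v];
    [rewrite !thinmx0 | rewrite [v]flatmx0 mulmx0 mxE].
move: L E; rewrite -[k.+1]/(1 + k)%N => L E.
rewrite -[L]submxK -[E]submxK.
move: (ulsubmx L) (ursubmx L) (dlsubmx L) (drsubmx L) => a z b L'.
move: (ulsubmx E) (ursubmx E) (dlsubmx E) (drsubmx E) => dE d d' E'.
rewrite (is_trig_block_mx _ _ _ _ erefl) => /and3P[/eqP-> _ L'trig] Ldiag.
rewrite adj_block_mx => /eq_block_mx[dEH _ <- E'H].
have La : 0 < a 0 0 + (a 0 0)^*.
  by have := Ldiag (lshift k 0); rewrite block_mxEul.
have Ld i : 0 < L' i i + (L' i i)^*.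
  by have := Ldiag (rshift 1 i); rewrite block_mxEdr.
apply: (lyapunov_block La _ _ dEH E'H); last by move=> F; apply: IH.
(* The diagonal entries conj(a) + l_i have positive real part, so none of them vanishes. *)
rewrite trigmx_unit ?is_trig_scalarD //; apply/forallP => i.
rewrite mxlinE mxE eqxx mulr1n; apply/negP => /eqP h.
have := addr_gt0 La (Ld i).
have -> : a 0 0 + (a 0 0)^* + (L' i i + (L' i i)^*) =
  ((a 0 0)^* + L' i i) + ((a 0 0)^* + L' i i)^*.
  by rewrite rmorphD /= conjCK; ring.
by rewrite h rmorph0 addr0 ltxx.
Qed.

(** An algebraic substitute for writing E as the integral of exp(-t M^H) Q exp(-t M) over t > 0. A
    unitary congruence makes M^H triangular and preserves both definiteness and the shape of the
    equation. *)
Lemma lyapunov k (M E : 'M[C]_k) :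
  (forall a, eigenvalue M a -> 0 < a + a^*) -> E^H = E ->
  hpsdmx (M^H *m E + E *m M) -> hpsdmx E.
Proof.
case: k M E => [|k] M E spec EH Q.
  by split=> [|v]; [rewrite !thinmx0 | rewrite [v]flatmx0 mulmx0 mxE].
have [P Pu] := @Schur _ _ M^H isT.
rewrite /similar_to /= (conjymx _ Pu) => Ptrig.
have PP : P *m P^H = 1%:M by apply/unitarymxP.
have PP' : P^H *m P = 1%:M by apply/mulmx1C.
set L := P *m M^H *m P^H in Ptrig.
have PE : hpsdmx (P *m E *m P^H).
  apply: (lyapunov_trig Ptrig) => [i||].
  (* The conjugate of a diagonal entry l of L is an eigenvalue of M: otherwise l - M^H, and with it
     l - L, would be invertible, although l - L is triangular with a zero on the diagonal. *)
  - rewrite addrC -[X in _ + X]conjCK; apply: spec.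
    rewrite -[eigenvalue _ _]negbK -eigenvalue_unitmx; apply/negP.
    rewrite -unitmx_tr -(map_unitmx Num.conj).
    rewrite adjmxD adjmxN adjmx_scalar conjCK => h.
    have : - (L i i)%:M + L \in unitmx.
      have -> : - (L i i)%:M + L = -1 *: ((L i i)%:M - L).
        by rewrite scaleN1r opprB addrC.
      rewrite (unitmxZ _ (unitrN1 _)).
      have -> : (L i i)%:M - L = P *m ((L i i)%:M - M^H) *m P^H.
        by rewrite mulmxBr mulmxBl mul_mx_scalar -scalemxAl PP scalemx1.
      rewrite !unitmx_mul h andbT (unitarymx_unit Pu).
      by rewrite (unitarymx_unit (_ : P^H \is unitarymx)) ?trmxC_unitary.
    rewrite -raddfN trigmx_unit ?is_trig_scalarD // => /forallP/(_ i)/negP.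
    by apply; rewrite mxlinE mxE eqxx mulr1n addNr.
  - by rewrite !adjmxM adjmxK EH mulmxA.
  have := hpsdmx_congr P^H Q; rewrite adjmxK mulmxDr mulmxDl.
  rewrite /L !adjmxM !adjmxK.
  rewrite !mulmxA -(mulmxA (P *m M^H) P^H P) PP' mulmx1.
  by rewrite -(mulmxA (P *m E) P^H P) PP' mulmx1.
have := hpsdmx_congr P PE; rewrite !mulmxA PP' mul1mx -mulmxA PP' mulmx1.
by [].
Qed.

End Lyapunov.

(** * Uniqueness for the Lyapunov equation, and invariant kernels *)

Section Stable.
Variable R : realType.
Local Notation C := R[i].

(** Both i E and -i E are Hermitian solutions with zero right-hand side, so both are positive
    semidefinite; a form that is nonnegative and nonpositive vanishes. *)
Lemma lyapunov_skew0 k (M E : 'M[C]_k) :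
  (forall a, eigenvalue M a -> 0 < a + a^*) -> E^H = - E ->
  M^H *m E + E *m M = 0 -> E = 0.
Proof.
move=> spec EH Q0.
have iQ (a : C) : M^H *m (a *: E) + (a *: E) *m M = 0.
  by rewrite -scalemxAl -scalemxAr -scalerDr Q0 scaler0.
have ipsd (a : C) : a^* = - a -> hpsdmx (a *: E).
  move=> aH; apply: (lyapunov spec).
    by rewrite adjmxZ aH EH scaleNr scalerN opprK.
  by rewrite iQ; split=> [|v]; rewrite ?adjmx0 // mulmx0 mul0mx mxE.
have i1 : ('i : C)^* = - 'i by rewrite conjCi.
have i2 : (- 'i : C)^* = - - 'i by rewrite rmorphN /= i1.
suff E0 (v : 'cV_k) : E *m v = 0.
  by apply/matrixP => i j; have /colP/(_ i) := E0 (delta_mx j 0);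
    rewrite -colE !mxE.
have [_ /(_ v) h1] := ipsd _ i1; have [_ /(_ v) h2] := ipsd _ i2.
have h : (v^H *m ('i *: E) *m v) 0 0 = 0.
  apply/le_anti; rewrite h1 andbT -oppr_ge0 -oppmxE -mulNmx -mulmxN.
  by rewrite -scaleNr.
have := hpsdmx_ker (ipsd _ i1) h.
by rewrite -scalemxAl => /eqP; rewrite scaler_eq0 (negPf (neq0Ci C)) => /eqP.
Qed.

(* If the kernel of V is stable under M, then it contains an eigenvector of M
   unless it vanishes. *)
Lemma stable_ker_inj n k (V : 'M[C]_(n, k)) (M : 'M[C]_k) :
  (forall r : 'cV_k, V *m r = 0 -> V *m (M *m r) = 0) ->
  (forall (r : 'cV_k) a, V *m r = 0 -> M *m r = a *: r -> r = 0) ->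
  forall r : 'cV_k, V *m r = 0 -> r = 0.
Proof.
move=> Vst Veig.
set K := row_base (kermx V^T).
have KV : V *m K^T = 0.
  apply: trmx_inj; rewrite trmx_mul trmxK trmx0.
  by apply/sub_kermxP; rewrite eq_row_base.
(* Subspaces are row spaces, whence the transposes: the rows of [K] span the kernel of V, and [Q]
   represents M on it. *)
have [Q KQ] : exists Q, K *m M^T = Q *m K.
  apply/submxP; rewrite (eqmxMr _ (eq_row_base _)) eq_row_base.
  apply/sub_kermxP/row_matrixP => i; rewrite 2!row_mul row0.
  have ri : V *m (row i (kermx V^T))^T = 0.
    by apply: trmx_inj; rewrite trmx_mul trmxK -row_mul mulmx_ker row0 trmx0.
  move: (row i _) ri => w ri.
  apply: trmx_inj; rewrite !trmx_mul !trmxK trmx0. exact: Vst.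
have K0 : \rank (kermx V^T) = 0%N.
  apply/eqP; rewrite -leqn0 leqNgt; apply/negP => rk.
  have [a /eigenvalueP[v vQ /negP]] := eigenvalue_closed Q rk; apply.
  rewrite -(mulmx_free_eq0 _ (row_base_free (kermx V^T))) -trmx_eq0.
  apply/eqP/(Veig _ a); first by rewrite trmx_mul mulmxA KV mul0mx.
  by apply: trmx_inj;
    rewrite trmx_mul trmxK -mulmxA KQ mulmxA vQ -scalemxAl linearZ /= trmxK.
move=> r Vr; have : (r^T <= kermx V^T)%MS.
  by apply/sub_kermxP; rewrite -trmx_mul Vr trmx0.
move/eqP: K0; rewrite mxrank_eq0 => /eqP ->; rewrite submx0 trmx_eq0.
by move/eqP.
Qed.

End Stable.

(** * Deflating subspaces *)

Section DeflatingSubspace.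
Variable R : realType.
Local Notation C := R[i].

(** The three block rows of the pencil identity at s = 0. Size and coefficients are left free so
    that the given subspace, the spectral subspaces of the Hamiltonian matrix and single
    eigenvectors (k = 1) are all instances. *)
Definition deflating n m k (A : 'M[C]_n) (B : 'M[C]_(n, m)) (G : 'M[C]_(m, n))
    (S : 'M[C]_m) (U V : 'M[C]_(n, k)) (W : 'M[C]_(m, k)) (M : 'M[C]_k) :=
  [/\ A *m V + B *m W = V *m M, A^H *m U + G^H *m W = - (U *m M)
    & B^H *m U + G *m V + S *m W = 0].

Section Equations.
Variables (n m k : nat) (A : 'M[C]_n) (B : 'M[C]_(n, m)) (G : 'M[C]_(m, n)).
Variables (S : 'M[C]_m) (U V : 'M[C]_(n, k)) (W : 'M[C]_(m, k)) (M : 'M[C]_k).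
Hypothesis UVW : deflating A B G S U V W M.
Hypothesis S_pd : hpdmx S.
Let X := - (U^H *m V).

(** Substituting the first two equations for V M and M^H U^H cancels the terms in A, and the third
    one eliminates B. What remains on the right is Hermitian. *)
Lemma deflating_lyapunov :
  M^H *m X + X *m M =
  W^H *m G *m V + V^H *m G^H *m W + W^H *m S *m W.
Proof.
have [e1 e2 e3] := UVW.
have e2' : M^H *m U^H = - (U^H *m A + W^H *m G).
  have /(congr1 (fun N => - N^H)) := e2.
  by rewrite adjmxN opprK adjmxM adjmxD !adjmxM !adjmxK => <-.
have e3' : U^H *m B = - (V^H *m G^H + W^H *m S).
  have /(congr1 (fun N => N^H)) := e3.
  rewrite adjmx0 !adjmxD !adjmxM adjmxK (_ : S^H = S); last by case: S_pd.
  by rewrite -addrA => /eqP; rewrite addr_eq0 => /eqP.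
rewrite /X mulmxN mulNmx -[X in _ - X]mulmxA -e1 mulmxDr !mulmxA e2' e3'.
rewrite !(mulmxDl, mulNmx) opprK opprB addrC addrA subrK.
by rewrite addrC addrA.
Qed.

(** X and X^H solve the same Lyapunov equation, so their difference is a skew-Hermitian solution of
    the homogeneous one. A stable M is handled by passing to -M. *)
Lemma deflating_herm :
  (forall a, eigenvalue M a -> 0 < a + a^*) \/
  (forall a, eigenvalue M a -> a + a^* < 0) -> X^H = X.
Proof.
have [SH _] := S_pd; have e := deflating_lyapunov; clearbody X.
have XH : M^H *m (X - X^H) + (X - X^H) *m M = 0.
  have e' : M^H *m X^H + X^H *m M = M^H *m X + X *m M.
    rewrite -[LHS]adjmxK adjmxD !adjmxM !adjmxK addrC e !adjmxD.
    rewrite !adjmxM !adjmxK !mulmxA (_ : S^H = S) // [X in X + _ = _]addrC.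
    by [].
  by rewrite mulmxBr mulmxBl addrACA -opprD e' subrr.
have skew : (X - X^H)^H = - (X - X^H).
  by rewrite adjmxD adjmxN adjmxK opprB.
move=> [] spec; apply/esym/eqP; rewrite -subr_eq0; apply/eqP.
  exact: lyapunov_skew0 spec skew XH.
apply: (@lyapunov_skew0 _ _ (- M) _ _ skew).
  move=> a h; have /spec : eigenvalue M (- a).
    have /eigenvalue_colP[r Mr r0] := h; apply/eigenvalue_colP; exists r => //.
    by rewrite scaleNr -Mr mulNmx opprK.
  by rewrite rmorphN /= -opprD oppr_lt0.
by rewrite adjmxN mulNmx mulmxN -opprD XH oppr0.
Qed.

Hypothesis X_herm : X^H = X.

(** Such an r lies in the kernel of the Hermitian X, so evaluating the Lyapunov equation at r kills
    its left side. On ker V only (W r)^H S (W r) survives; on ker U the third equation turns the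
    cross terms into -2 times that quantity. Definiteness of S concludes. *)
Lemma deflating_ker_W (r : 'cV[C]_k) : V *m r = 0 \/ U *m r = 0 -> W *m r = 0.
Proof.
move=> VUr; have Xr : X *m r = 0.
  case: VUr => z; first by rewrite /X mulNmx -mulmxA z mulmx0 oppr0.
  by rewrite -X_herm /X adjmxN adjmxM adjmxK mulNmx -mulmxA z mulmx0 oppr0.
have rX : r^H *m X = 0 by rewrite -X_herm -adjmxM Xr adjmx0.
apply: (hpdmx_ker S_pd).
have := congr1 (fun N => r^H *m N *m r) deflating_lyapunov.
have -> : r^H *m (M^H *m X + X *m M) *m r = 0.
  rewrite mulmxDr mulmxDl !mulmxA rX mul0mx mul0mx addr0.
  by rewrite -!mulmxA Xr !mulmx0.
case: VUr => z.
  rewrite !(mulmxDr, mulmxDl) !mulmxA -[_ *m V *m r]mulmxA z mulmx0 add0r.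
  by rewrite -(adjmxM V r) z adjmx0 !mul0mx add0r adjmxM => <-.
have [_ _ e3] := UVW.
have Wr : G *m (V *m r) = - (S *m (W *m r)).
  have /(congr1 (fun N => N *m r)) := e3.
  rewrite !mulmxDl mul0mx -!mulmxA z mulmx0 add0r.
  by move=> /eqP; rewrite addr_eq0 => /eqP.
have Wr' : (V *m r)^H *m G^H = - ((W *m r)^H *m S).
  by rewrite -adjmxM Wr adjmxN adjmxM (_ : S^H = S) //; case: S_pd.
rewrite !(mulmxDr, mulmxDl) !mulmxA -(adjmxM V r) -(adjmxM W r).
rewrite -[_ *m V *m r]mulmxA -![_ *m W *m r]mulmxA -[_ *m G *m _]mulmxA.
rewrite Wr Wr' mulmxN mulNmx !mulmxA.
by rewrite subrK => /eqP; rewrite eq_sym oppr_eq0 => /eqP.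
Qed.

Hypothesis UVW_inj : forall r : 'cV[C]_k,
  U *m r = 0 -> V *m r = 0 -> W *m r = 0 -> r = 0.

(** As W vanishes on ker V, that kernel is invariant under M. For an eigenvector r in it, U r is an
    eigenvector of A^H killed by B^H, which controllability forbids unless U r = 0. *)
Lemma deflating_injV :
  (forall (q : 'cV[C]_n) a, A^H *m q = a *: q -> B^H *m q = 0 -> q = 0) ->
  forall r : 'cV[C]_k, V *m r = 0 -> r = 0.
Proof.
move=> ctrl; have [e1 e2 e3] := UVW.
apply: (@stable_ker_inj _ _ _ _ M) => [r Vr|r a Vr Mr].
  have Wr := deflating_ker_W (or_introl Vr).
  by rewrite mulmxA -e1 mulmxDl -!mulmxA Vr Wr !mulmx0 addr0.
have Wr := deflating_ker_W (or_introl Vr).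
apply: UVW_inj => //; apply: (ctrl _ (- a)).
  have /(congr1 (fun N => N *m r)) := e2.
  rewrite mulmxDl mulNmx -!mulmxA Wr mulmx0 addr0 => ->.
  by rewrite Mr -scalemxAr scaleNr.
have /(congr1 (fun N => N *m r)) := e3.
by rewrite !mulmxDl -!mulmxA Vr Wr !mulmx0 !addr0 mul0mx.
Qed.

(** Here an eigenvector r of M in ker U makes V r an eigenvector of A for the same eigenvalue, which
    would lie in both open half planes. *)
Lemma deflating_injU :
  (forall a, eigenvalue A a -> a + a^* < 0) ->
  (forall a, eigenvalue M a -> 0 < a + a^*) ->
  forall r : 'cV[C]_k, U *m r = 0 -> r = 0.
Proof.
move=> specA specM; have [e1 e2 e3] := UVW.
apply: (@stable_ker_inj _ _ _ _ M) => [r Ur|r a Ur Mr].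
  have Wr := deflating_ker_W (or_intror Ur).
  rewrite mulmxA -[U *m M]opprK -e2 mulNmx mulmxDl -!mulmxA Ur Wr !mulmx0 addr0.
  by rewrite oppr0.
have Wr := deflating_ker_W (or_intror Ur).
apply/eqP/negPn/negP => r0.
have /specM a0 : eigenvalue M a by apply/eigenvalue_colP; exists r.
suff Vr : V *m r = 0 by rewrite (UVW_inj Ur Vr Wr) eqxx in r0.
apply/eqP/negPn/negP => Vr.
have /specA : eigenvalue A a.
  apply/eigenvalue_colP; exists (V *m r) => //.
  have /(congr1 (fun N => N *m r)) := e1.
  by rewrite mulmxDl -!mulmxA Wr mulmx0 addr0 => ->; rewrite Mr -scalemxAr.
by move=> /(lt_trans a0); rewrite ltxx.
Qed.

End Equations.
End DeflatingSubspace.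

(** * Spectral splitting and the Lur'e equations *)

Section Split.
Variable R : realType.
Local Notation C := R[i].

Lemma horner_mx_eigen n (g : 'M[C]_n.+1) (p : {poly C}) (v : 'rV[C]_n.+1) a :
  v *m g = a *: v -> v *m horner_mx g p = p.[a] *: v.
Proof.
move=> vg; elim/poly_ind: p => [|p c IH].
  by rewrite rmorph0 horner0 scale0r mulmx0.
rewrite rmorphD rmorphM /= horner_mx_X horner_mx_C hornerMXaddC mulmxDr.
rewrite -mulmxE mulmxA IH -scalemxAl vg scalerA mul_mx_scalar.
by rewrite -scalerDl.
Qed.

(** The column basis [Y] is the transpose of a row basis for [g^T]. An eigenvector of [M] for a
    yields an eigenvector w of [g^T] killed by the polynomial, so p(a) w = 0. *)
Lemma kermxpoly_basis n (g : 'M[C]_n) (p : {poly C}) :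
  exists (Y : 'M[C]_(n, \rank (kermxpoly g^T p))) M,
  [/\ g *m Y = Y *m M, forall r : 'cV_(_), Y *m r = 0 -> r = 0 &
      forall a, eigenvalue M a -> root p a].
Proof.
set K := kermxpoly g^T p.
have [Q KQ] : exists Q, row_base K *m g^T = Q *m row_base K.
  apply/submxP; rewrite (eqmxMr _ (eq_row_base _)) eq_row_base.
  exact: comm_mx_stable_kermxpoly.
exists (row_base K)^T, Q^T.
have Yinj (r : 'cV_(\rank K)) : (row_base K)^T *m r = 0 -> r = 0.
  move=> /(congr1 trmx); rewrite trmx_mul trmxK trmx0 => /eqP.
  by rewrite mulmx_free_eq0 ?row_base_free // trmx_eq0 => /eqP.
split=> //.
  by apply: trmx_inj; rewrite !trmx_mul !trmxK.
move=> a /eigenvalue_colP[r Qr r0].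
set w := r^T *m row_base K.
have w0 : w != 0 by rewrite mulmx_free_eq0 ?row_base_free // trmx_eq0.
have wg : w *m g^T = a *: w.
  rewrite /w -mulmxA KQ mulmxA scalemxAl; congr (_ *m _).
  by apply: trmx_inj; rewrite trmx_mul trmxK Qr linearZ /= trmxK.
have : (w <= K)%MS by rewrite -(eq_row_base K) submxMl.
rewrite /K; clearbody w; clear r Qr r0 KQ Q Yinj K.
move: g w w0 wg; case: n => [|n] g w w0 wg.
  by rewrite [w]thinmx0 eqxx in w0.
move=> /sub_kermxP; rewrite (horner_mx_eigen _ wg) => /eqP.
by rewrite scaler_eq0 (negPf w0) orbF.
Qed.

(** Sorting the roots of the characteristic polynomial by the sign of their real part gives two
    coprime factors, whose kernels span everything by Cayley-Hamilton. The bound on k1 + k2 serves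
    to turn an upper bound on k2 into a lower bound on k1. *)
Lemma spectral_split n (g : 'M[C]_n) :
  (forall a, eigenvalue g a -> a + a^* != 0) ->
  exists k1 k2 (Y1 : 'M[C]_(n, k1)) M1 (Y2 : 'M[C]_(n, k2)) M2,
  [/\ [/\ g *m Y1 = Y1 *m M1, forall r : 'cV_k1, Y1 *m r = 0 -> r = 0 &
      forall a, eigenvalue M1 a -> 0 < a + a^*],
      [/\ g *m Y2 = Y2 *m M2, forall r : 'cV_k2, Y2 *m r = 0 -> r = 0 &
      forall a, eigenvalue M2 a -> a + a^* < 0] &
      (n <= k1 + k2)%N].
Proof.
move=> noim.
have [rs rsE] := closed_field_poly_normal (char_poly g^T).
rewrite (monicP (char_poly_monic _)) scale1r in rsE.
pose P (z : C) := 0 < z + z^*.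
pose p1 := \prod_(z <- rs | P z) ('X - z%:P).
pose p2 := \prod_(z <- rs | ~~ P z) ('X - z%:P).
have root1 a : root p1 a -> 0 < a + a^*.
  rewrite /p1 -big_filter root_prod_XsubC mem_filter.
  by case/andP.
have root2 a : root p2 a -> a + a^* < 0.
  rewrite /p2 -big_filter root_prod_XsubC mem_filter => /andP[nPa ars].
  have : eigenvalue g a.
    by rewrite -eigenvalue_trmx eigenvalue_root_char rsE root_prod_XsubC.
  move=> /noim a0; rewrite lt_neqAle a0 /=.
  have ar : a + a^* \is Num.real by rewrite CrealE rmorphD /= conjCK addrC.
  by rewrite real_leNgt // real0.
have cop : coprimep p1 p2.
  apply/Pdiv.ClosedField.coprimepP => a /root1 a1; apply/negP => /root2.
  by move=> /(lt_trans a1); rewrite ltxx.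
have [Y1 [M1 [e1 i1 s1]]] := kermxpoly_basis g p1.
have [Y2 [M2 [e2 i2 s2]]] := kermxpoly_basis g p2.
exists (\rank (kermxpoly g^T p1)), (\rank (kermxpoly g^T p2)).
exists Y1, M1, Y2, M2; split.
- by split=> [||a /s1/root1]; [exact: e1 | exact: i1 |].
- by split=> [||a /s2/root2]; [exact: e2 | exact: i2 |].
apply: leq_trans (mxrank_adds_leqif _ _).
have pE : char_poly g^T = p1 * p2 by rewrite rsE (bigID P).
rewrite -(kermxpolyM _ cop) -pE.
clear; case: n g => // n g.
by rewrite kermxpoly_min ?mxrank1 // mxminpoly_dvd_char.
Qed.

End Split.

(** * Solving the Lur'e equations *)

Section Lure.
Variable R : realType.
Local Notation C := R[i].

Lemma hpdmx_unit k (S : 'M[C]_k) : hpdmx S -> S \in unitmx.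
Proof.
move=> Spd; have : 0%:M - S \in unitmx.
  rewrite eigenvalue_unitmx; apply/negP => /eigenvalue_colP[v Sv].
  by rewrite (hpdmx_ker (v := v) Spd) ?eqxx // -mulmxA Sv scale0r mulmx0.
by rewrite raddf0 sub0r -scaleN1r unitmxZ ?unitrN1.
Qed.

Lemma row_free_colP n k (V : 'M[C]_(n, k)) :
  (forall r : 'cV_k, V *m r = 0 -> r = 0) -> row_free V^T.
Proof.
move=> Vinj; rewrite -kermx_eq0; apply/rowV0P => w /sub_kermxP wV.
apply: trmx_inj; rewrite trmx0; apply: Vinj.
by apply: trmx_inj; rewrite trmx_mul trmxK wV trmx0.
Qed.

(* The certificate P is read off the n-dimensional deflating subspace for the
   open right half plane. *)
Lemma lure_solution n m (A : 'M[C]_n) (B : 'M[C]_(n, m)) (G : 'M[C]_(m, n))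
    (S : 'M[C]_m) :
  hpdmx S -> (forall a, eigenvalue A a -> a + a^* < 0) ->
  (forall (q : 'cV[C]_n) a, A^H *m q = a *: q -> B^H *m q = 0 -> q = 0) ->
  (forall (x l : 'cV[C]_n) (u : 'cV[C]_m) a, a + a^* = 0 ->
     A *m x + B *m u = a *: x -> A^H *m l + G^H *m u = - (a *: l) ->
     B^H *m l + G *m x + S *m u = 0 -> x = 0 /\ l = 0) ->
  exists (P : 'M[C]_n) (L : 'M[C]_(m, n)),
  [/\ hpdmx P, - (A^H *m P) - P *m A = L^H *m S *m L
    & G - B^H *m P = - (S *m L)].
Proof.
move=> Spd specA ctrl noim; have Su := hpdmx_unit Spd.
(* [T] is the feedback obtained by solving the third block equation for W, and [H] is the resulting
   Hamiltonian matrix; vectors are stacked in the order (V, U). *)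
pose T := - (invmx S *m row_mx G B^H).
pose H := block_mx A 0 0 (- A^H) + col_mx B (- G^H) *m T.
have TE k (V U : 'M[C]_(n, k)) :
    T *m col_mx V U = - (invmx S *m (G *m V + B^H *m U)).
  by rewrite /T mulNmx -mulmxA mul_row_col.
have HE k (V U : 'M[C]_(n, k)) : H *m col_mx V U =
    col_mx (A *m V + B *m (T *m col_mx V U))
           (- (A^H *m U) - G^H *m (T *m col_mx V U)).
  rewrite /H mulmxDl mul_block_col -mulmxA mul_col_mx add_col_mx !mul0mx.
  by rewrite !mulNmx addr0 add0r.
have defl0 k (V U : 'M[C]_(n, k)) M : H *m col_mx V U = col_mx V U *m M ->
    deflating A B G S U V (T *m col_mx V U) M.
  rewrite HE mul_col_mx => /eq_col_mx[e1 e2].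
  split; first exact: e1.
    by rewrite -e2 opprB opprK addrC.
  by rewrite TE mulmxN mulKVmx // [G *m _ + _]addrC subrr.
have defl k (Y : 'M[C]_(n + n, k)) M : H *m Y = Y *m M ->
    deflating A B G S (dsubmx Y) (usubmx Y) (T *m Y) M.
  by have := @defl0 _ (usubmx Y) (dsubmx Y) M; rewrite vsubmxK; apply.
have Hnoim a : eigenvalue H a -> a + a^* != 0.
  move=> /eigenvalue_colP[y Hy y0]; apply/eqP => a0.
  have Hy' : H *m y = y *m a%:M by rewrite mul_mx_scalar.
  have [e1 e2 e3] := defl _ _ _ Hy'.
  move: e1 e2; rewrite !mul_mx_scalar => e1 e2.
  have [yu yd] := noim _ _ _ _ a0 e1 e2 e3.
  by rewrite -[y]vsubmxK yu yd col_mx0 eqxx in y0.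
have [k1 [k2 [Y1 [M1 [Y2 [M2 [[/defl d1 i1 s1] [/defl d2 i2 s2] nk]]]]]]] :=
  spectral_split Hnoim.
have joint k (Y : 'M[C]_(n + n, k)) : (forall r : 'cV_k, Y *m r = 0 -> r = 0) ->
    forall r : 'cV_k, dsubmx Y *m r = 0 -> usubmx Y *m r = 0 ->
      T *m Y *m r = 0 -> r = 0.
  move=> Yinj r Ur Vr _; apply: Yinj.
  by rewrite -[Y]vsubmxK mul_col_mx Ur Vr col_mx0.
have X1 := deflating_herm d1 Spd (or_introl s1).
have X2 := deflating_herm d2 Spd (or_intror s2).
have V1 := deflating_injV d1 Spd X1 (joint _ _ i1) ctrl.
have V2 := deflating_injV d2 Spd X2 (joint _ _ i2) ctrl.
have U1 := deflating_injU d1 Spd X1 (joint _ _ i1) specA s1.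
(* Injectivity of V on the stable part bounds k2 by n, so k1 is at least n; V is injective on the
   antistable part as well, hence bijective there. *)
have rk2 : (k2 <= n)%N.
  by rewrite -(eqP (row_free_colP V2)) rank_leq_col.
have V1full : row_free (usubmx Y1).
  rewrite /row_free eqn_leq rank_leq_row -mxrank_tr (eqP (row_free_colP V1)).
  by rewrite -(leq_add2r k2) (leq_trans _ nk) // leq_add2l.
move: d1 X1 V1 U1 V1full; clear - Spd specA.
move: (dsubmx Y1) (usubmx Y1) (T *m Y1) => U V W UVW XH Vinj Uinj Vfull.
have [e1 e2 e3] := UVW.
(* The number of columns equals n only propositionally, so the inverse of V is carried as a
   two-sided inverse between two sizes. *)
have [V' VV'] : exists V', V *m V' = 1%:M.
  by exists (pinvmx V); rewrite -[LHS]mul1mx mulmxA mulmxKp.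
have V'V : V' *m V = 1%:M.
  have Vrf : row_full V by rewrite /row_full -mxrank_tr; apply: row_free_colP.
  have [Q QV] := row_fullP Vrf.
  by rewrite -[V']mul1mx -QV -!mulmxA (mulmxA V) VV' mul1mx.
pose P := - (U *m V'); pose L := W *m V'.
have PV : P *m V = - U by rewrite /P mulNmx -mulmxA V'V mulmx1.
have PH : P^H = P.
  have /(congr1 (fun N => V'^H *m N *m V')) := XH.
  rewrite /P adjmxN adjmxM adjmxK !(mulmxN, mulNmx) !mulmxA -adjmxM VV' adjmx1.
  by rewrite mul1mx -[_ *m V *m V']mulmxA VV' mulmx1 -adjmxM -adjmxN => <-.
have eG : G - B^H *m P = - (S *m L).
  have /(congr1 (fun N => N *m V')) := e3.
  rewrite !mulmxDl mul0mx -!mulmxA VV' mulmx1 => /eqP; rewrite addr_eq0.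
  by move=> /eqP <-; rewrite /P mulmxN opprK addrC mulmxA.
have SH : S^H = S by case: Spd.
have eG' : G^H - P *m B = - (L^H *m S).
  by rewrite -[L^H *m S]adjmxK adjmxM SH adjmxK -adjmxN -eG adjmxD adjmxN adjmxM
     adjmxK PH.
have eP : - (A^H *m P) - P *m A = L^H *m S *m L.
  rewrite -[RHS]opprK -(mulNmx (L^H *m S)) -eG' mulmxBl opprB.
  have AU : A^H *m U = - (U *m M1) - G^H *m W by rewrite -e2 addrK.
  have -> : A^H *m P = U *m M1 *m V' + G^H *m L.
    by rewrite /P mulmxN mulmxA AU mulmxBl mulNmx -opprD opprK mulmxA.
  have AE : A = V *m M1 *m V' - B *m L.
    by rewrite -e1 mulmxDl -!mulmxA VV' mulmx1 addrK.
  have -> : P *m A = - (U *m M1 *m V') - P *m B *m L.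
    by rewrite {1}AE mulmxBr !mulmxA PV !mulNmx.
  move: (U *m M1 *m V') (G^H *m L) (P *m B *m L) => x y z.
  by rewrite !opprD !opprK addrACA addNr add0r addrC.
clearbody P L.
(* Since -A is antistable and L^H S L is semidefinite, so is P. Definiteness then follows from P V =
   -U and the injectivity of U. *)
have Ppsd : hpsdmx P.
  apply: (@lyapunov _ _ (- A) _ _ PH) => [a /eigenvalue_colP[r Ar r0]|].
    have /specA : eigenvalue A (- a).
      by apply/eigenvalue_colP; exists r; rewrite // scaleNr -Ar mulNmx opprK.
    by rewrite rmorphN /= -opprD oppr_lt0.
  rewrite adjmxN mulNmx mulmxN eP; apply/hpsdmx_congr/hpdmx_psd/Spd.
exists P, L; split=> //; split=> // v v0.
rewrite lt_neqAle (Ppsd.2 v) andbT.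
apply/negP => /eqP/esym/(hpsdmx_ker Ppsd) Pv.
have : V' *m v = 0.
  apply: Uinj; apply: oppr_inj; rewrite oppr0 -mulNmx -PV -mulmxA (mulmxA V).
  by rewrite VV' mul1mx.
by move=> /(congr1 (mulmx V)); rewrite mulmxA VV' mul1mx mulmx0 => /eqP/negPn;
  rewrite v0.
Qed.

End Lure.

(** * Comparison of X with the full certificate P *)

Section Gram.
Variable R : realType.
Local Notation C := R[i].

(** [A] and [S] belong to the level xi, whereas [P] and [L] solve the Lur'e equations at xi' = xi +
    2 d, with coefficients A + d and S - 2 d. *)
Lemma deflating_gram_pd n m k (A : 'M[C]_n) (B : 'M[C]_(n, m))
    (G : 'M[C]_(m, n)) (S : 'M[C]_m) (U V : 'M[C]_(n, k)) (W : 'M[C]_(m, k))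
    (M : 'M[C]_k) (P : 'M[C]_n) (L : 'M[C]_(m, n)) (d : C) :
  deflating A B G S U V W M ->
  (forall a, eigenvalue M a -> 0 < a + a^*) ->
  (forall r : 'cV[C]_k, V *m r = 0 -> r = 0) ->
  (- (U^H *m V))^H = - (U^H *m V) ->
  0 <= d -> hpdmx S -> hpdmx P -> hpdmx (S - (d + d)%:M) ->
  - ((A + d%:M)^H *m P) - P *m (A + d%:M) = L^H *m (S - (d + d)%:M) *m L ->
  G - B^H *m P = - ((S - (d + d)%:M) *m L) ->
  hpdmx (- (U^H *m V)).
Proof.
move=> UVW specM Vinj XH d0 Spd Ppd; set S' := S - _ => S'pd eP eG.
have [PH _] := Ppd; have [S'H _] := S'pd.
have SE : S = S' + (d + d)%:M by rewrite /S' subrK.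
have XM := deflating_lyapunov UVW Spd; have [e1 e2 e3] := UVW.
move: (- (U^H *m V)) XH XM => X XH XM; clearbody S'.
pose E := X - V^H *m P *m V.
have Epsd : hpsdmx E.
  apply: (lyapunov specM).
    by rewrite /E adjmxD adjmxN !adjmxM adjmxK XH (_ : P^H = P) // mulmxA.
  have PA : A^H *m P + P *m A = - (L^H *m S' *m L) - (d + d) *: P.
    rewrite -eP adjmxD adjmx_scalar geC0_conj // mulmxDl mulmxDr.
    rewrite mul_scalar_mx mul_mx_scalar scalerDl.
    move: (A^H *m P) (P *m A) (d *: P) => x y z.
    by apply/matrixP => i j; rewrite !mxE; ring.
  have BP : B^H *m P = G + S' *m L.
    by rewrite -[S' *m L]opprK -eG opprB addrC subrK.
  have PB : P *m B = G^H + L^H *m S'.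
    rewrite -[LHS]adjmxK adjmxM (_ : P^H = P) // BP adjmxD adjmxM.
    by rewrite (_ : S'^H = S').
  (* Completing the square: the first term measures how far W is from the feedback L V, and the
     second collects the gap 2 d between the two levels. *)
  have -> : M^H *m E + E *m M =
      (L *m V - W)^H *m S' *m (L *m V - W)
      + (d + d) *: (W^H *m W + V^H *m P *m V).
    have VPV : M^H *m (V^H *m P *m V) + V^H *m P *m V *m M =
        V^H *m (A^H *m P + P *m A) *m V + W^H *m (B^H *m P) *m V
        + V^H *m (P *m B) *m W.
      rewrite mulmxA mulmxA -adjmxM -[_ *m V *m M]mulmxA -e1.
      rewrite adjmxD !adjmxM !mulmxDl !mulmxDr !mulmxA mulmxDl.
      move: (V^H *m A^H *m P *m V) (V^H *m P *m A *m V) => x y.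
      move: (W^H *m B^H *m P *m V) (V^H *m P *m B *m W) => z t.
      by apply/matrixP => i j; rewrite !mxE; ring.
    rewrite /E mulmxBr mulmxBl addrACA -opprD XM VPV PA BP PB.
    rewrite SE adjmxD adjmxN adjmxM.
    rewrite !(mulmxDl, mulmxDr, mulmxN, mulNmx) !mulmxA.
    rewrite -!scalemxAr -!scalemxAl mul_mx_scalar -!scalemxAl.
    move: (W^H *m G *m V) (V^H *m G^H *m W) (W^H *m S' *m W).
    move: (V^H *m L^H *m S' *m L *m V) (W^H *m S' *m L *m V).
    move: (V^H *m L^H *m S' *m W) (W^H *m W) (V^H *m P *m V).
    by move=> x1 x2 x3 x4 x5 x6 x7 x8; apply/matrixP => i j; rewrite !mxE; ring.
  apply: hpsdmxD; first exact/hpsdmx_congr/hpdmx_psd.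
  apply: hpsdmxZ; first exact: addr_ge0.
  apply: hpsdmxD; first exact: hpsdmx_gram.
  exact/hpsdmx_congr/hpdmx_psd.
split=> // v v0.
have -> : X = V^H *m P *m V + E by rewrite /E addrC subrK.
rewrite mulmxDr mulmxDl mxlinE ltr_wpDr ?(Epsd.2 v) //.
rewrite !mulmxA -adjmxM -mulmxA; apply: Ppd.2.
by apply: contra v0 => /eqP/Vinj ->.
Qed.

End Gram.

(** * Real matrices inside complex ones *)

Section Bridge.
Variable R : realType.
Local Notation C := R[i].

Lemma adj_cmx m n (M : 'M[R]_(m, n)) : (cmx M)^H = cmx M^T.
Proof.
by apply/matrixP => i j; rewrite !mxE; apply/CrealP; rewrite complex_real.
Qed.

Lemma cmxM m n p (M : 'M[R]_(m, n)) (N : 'M[R]_(n, p)) :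
  cmx (M *m N) = cmx M *m cmx N.
Proof. exact: map_mxM. Qed.

Lemma cmxD m n (M N : 'M[R]_(m, n)) : cmx (M + N) = cmx M + cmx N.
Proof. exact: map_mxD. Qed.

Lemma cmxN m n (M : 'M[R]_(m, n)) : cmx (- M) = - cmx M.
Proof. exact: map_mxN. Qed.

Lemma cmx_scalar n (a : R) : cmx (a%:M : 'M[R]_n) = (a%:C)%C%:M.
Proof. exact: map_scalar_mx. Qed.

Lemma cmx0 m n : cmx (0 : 'M[R]_(m, n)) = 0.
Proof. exact: map_mx0. Qed.

Lemma cmx_inj m n : injective (@cmx R m n).
Proof. by apply: map_mx_inj. Qed.

Lemma addCconj (a : C) : a + a^* = ((2 * complex.Re a)%:C)%C.
Proof. by rewrite rmorphM rmorph_nat; exact: addcJ. Qed.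

Lemma addCconj_gt0 (a : C) : (0 < a + a^*) = (0 < complex.Re a).
Proof. by rewrite addCconj ltcR pmulr_rgt0. Qed.

Lemma addCconj_lt0 (a : C) : (a + a^* < 0) = (complex.Re a < 0).
Proof. by rewrite addCconj ltcR pmulr_rlt0. Qed.

Lemma cmx_form k (M : 'M[R]_k) (v : 'cV[R]_k) :
  ((cmx v)^H *m cmx M *m cmx v) 0 0 = (((v^T *m M *m v) 0 0)%:C)%C.
Proof. by rewrite adj_cmx -!cmxM mxE. Qed.

Lemma cV_split k (v : 'cV[C]_k) :
  exists a b : 'cV[R]_k, v = cmx a + 'i *: cmx b.
Proof.
exists (\col_i complex.Re (v i 0)), (\col_i complex.Im (v i 0)).
by apply/colP => i; rewrite !mxE -complexiE; exact: complexE.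
Qed.

(** By symmetry the two cross terms are equal, and they carry the factors i and -i. *)
Lemma cmx_form_split k (M : 'M[R]_k) (a b : 'cV[R]_k) :
  M^T = M ->
  ((cmx a + 'i *: cmx b)^H *m cmx M *m (cmx a + 'i *: cmx b)) 0 0
  = (((a^T *m M *m a) 0 0 + (b^T *m M *m b) 0 0)%:C)%C.
Proof.
move=> MT; rewrite adjmxD adjmxZ conjCi !(mulmxDl, mulmxDr).
rewrite -!scalemxAl -!scalemxAr !mxlinE.
rewrite !cmx_form.
rewrite rmorphD /=.
have -> : ((cmx b)^H *m cmx M *m cmx a) 0 0 = ((cmx a)^H *m cmx M *m cmx b) 0 0.
  rewrite !adj_cmx -!cmxM.
  have -> : b^T *m M *m a = (a^T *m M *m b)^T.
    by rewrite !trmx_mul trmxK MT mulmxA.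
  by rewrite !mxE.
set x := ((cmx a)^H *m cmx M *m cmx b) 0 0.
clearbody x; have i2 := sqrCi C.
by rewrite mulNr addrA subrK !mulNr mulrA -expr2 i2 mulN1r opprK.
Qed.

Lemma psdmx_cmx k (M : 'M[R]_k) : psdmx M -> hpsdmx (cmx M).
Proof.
move=> [MT M0]; split; first by rewrite adj_cmx MT.
move=> v; have [a [b ->]] := cV_split v.
by rewrite cmx_form_split // lecR addr_ge0.
Qed.

Lemma pdmx_cmx k (M : 'M[R]_k) : pdmx M -> hpdmx (cmx M).
Proof.
move=> [MT M0]; split; first by rewrite adj_cmx MT.
have M1 (a : 'cV_k) : 0 <= (a^T *m M *m a) 0 0.
  by have [->|/M0/ltW//] := eqVneq a 0; rewrite mulmx0 mxE.
move=> v; have [a [b ->]] := cV_split v.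
rewrite cmx_form_split // ltcR.
have [->|a0 _] := eqVneq a 0; last by rewrite ltr_wpDr // M0.
have [->|b0 _] := eqVneq b 0; last by rewrite ltr_wpDl // M0.
by rewrite cmx0 scaler0 addr0 eqxx.
Qed.

Lemma hpdmx_cmx k (M : 'M[R]_k) : hpdmx (cmx M) -> pdmx M.
Proof.
move=> [MH M0]; split.
  by apply: cmx_inj; rewrite -adj_cmx.
move=> v v0; rewrite -ltcR -cmx_form; apply: M0.
by rewrite -(cmx0 k 1) (inj_eq (@cmx_inj _ _)).
Qed.

End Bridge.

(** * From strict passivity to the Lur'e equations *)

Section StrictlyPassive.
Variable R : realType.
Local Notation C := R[i].

(** One direction of the Popov-Belevitch-Hautus test: q^H A^k B is a multiple of q^H B = 0 for every
    k, so q^H annihilates the controllability matrix, which has full row rank. *)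
Lemma controllable_pbh n m (M : model R n m) (q : 'cV[C]_n) a :
  controllable M -> (cmx (mA M))^H *m q = a *: q ->
  (cmx (mB M))^H *m q = 0 -> q = 0.
Proof.
rewrite /controllable; case: M => A B G D /= ctrl qA qB.
set K := \mxrow_k _ in ctrl.
have Kfree : row_free (cmx K) by rewrite /row_free mxrank_map ctrl.
have qA' : q^H *m cmx A = a^* *: q^H.
  by rewrite -adjmxZ -qA adjmxM adjmxK.
have qB' : q^H *m cmx B = 0 by rewrite -[cmx B]adjmxK -adjmxM qB adjmx0.
have qAk k : q^H *m cmx (A ^+ k) = a^* ^+ k *: q^H.
  elim: k => [|k IH].
    by rewrite !expr0 scale1r (_ : cmx 1 = 1%:M) ?mulmx1 // /cmx map_mx1.
  rewrite exprS (_ : A * A ^+ k = A *m A ^+ k) // cmxM mulmxA qA' -scalemxAl IH.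
  by rewrite scalerA exprS.
rewrite -[q]adjmxK (_ : q^H = 0) ?adjmx0 //.
apply/eqP; rewrite -(mulmx_free_eq0 _ Kfree); apply/eqP/mxrowP => k.
rewrite -mul_submxrow submxrow0.
have -> : submxrow (cmx K) k = cmx (submxrow K k).
  by apply/matrixP => i j; rewrite !mxE.
by rewrite mxrowK cmxM mulmxA qAk -scalemxAl qB' scaler0.
Qed.

Lemma adj_cmx_tr n m (M : 'M[R]_(n, m)) : (cmx M)^H = (cmx M)^T.
Proof. by rewrite adj_cmx /cmx map_trmx. Qed.

(** On the imaginary axis the first two equations give x and l as resolvents applied to u, and the
    third becomes Phi(a) u = 0; strict positive realness forces u = 0. Controllability enters in
    eigenvector form because that form passes easily to a shifted A. *)
Lemma strictly_passive_lure n m (M : model R n m) :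
  strictly_passive M ->
  (forall (q : 'cV[C]_n) a, (cmx (mA M))^H *m q = a *: q ->
     (cmx (mB M))^H *m q = 0 -> q = 0) ->
  exists (P : 'M[C]_n) (L : 'M[C]_(m, n)),
  [/\ hpdmx P,
      - ((cmx (mA M))^H *m P) - P *m cmx (mA M)
      = L^H *m cmx ((mD M)^T + mD M) *m L
    & cmx (mC M) - (cmx (mB M))^H *m P = - (cmx ((mD M)^T + mD M) *m L)].
Proof.
move=> [spr stab Dpd] pbh; apply: lure_solution => //.
- exact: pdmx_cmx.
- by move=> a /stab; rewrite addCconj_lt0.
move=> x l u a a0 ex el e0.
have Ra : complex.Re a = 0.
  move: a0; rewrite addCconj => /eqP.
  by rewrite (fmorph_eq0 (real_complex R)) mulf_eq0 pnatr_eq0 => /eqP.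
have reg (s : C) : complex.Re s = 0 -> s%:M - cmx (mA M) \in unitmx.
  move=> s0; rewrite eigenvalue_unitmx; apply/negP => /stab.
  by rewrite s0 ltxx.
have rega := reg _ Ra.
have regNa : (- a)%:M - cmx (mA M) \in unitmx.
  by apply: reg; case: (a) Ra => y z /= ->; rewrite oppr0.
have Phi_pd s : complex.Re s = 0 -> regular_at M s -> hpdmx (Phi M s).
  by case: s => y z /= ->; apply: spr.
have xE : x = invmx (a%:M - cmx (mA M)) *m (cmx (mB M) *m u).
  apply: (can_inj (mulKmx rega)).
  rewrite (mulKVmx rega) mulmxBl mul_scalar_mx -ex.
  by rewrite addrC addKr.
have el' : ((- a)%:M - cmx (mA M))^T *m l = (cmx (mC M))^T *m u.
  rewrite linearB /= tr_scalar_mx mulmxBl mul_scalar_mx scaleNr -el.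
  by rewrite !adj_cmx_tr addrC addKr.
have lE : l = (invmx ((- a)%:M - cmx (mA M)))^T *m ((cmx (mC M))^T *m u).
  have regT : ((- a)%:M - cmx (mA M))^T \in unitmx by rewrite unitmx_tr.
  by rewrite trmx_inv -el' (mulKmx regT).
have Pu : Phi M a *m u = 0.
  rewrite -[RHS]e0 /Phi /tf !linearD /= !trmx_mul adj_cmx_tr cmxD !mulmxDl.
  rewrite -!mulmxA -lE -xE /cmx -map_trmx.
  by rewrite addrACA !addrA.
have u0 : u = 0.
  by apply: (hpdmx_ker (Phi_pd _ Ra rega)); rewrite -mulmxA Pu mulmx0.
by rewrite xE lE u0 !mulmx0.
Qed.

End StrictlyPassive.

(** * The given deflating subspace at level xi *)

Section ShiftedPencil.
Variable R : realType.
Local Notation C := R[i].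

Lemma col_rank_inj n k (Y : 'M[R]_(n, k)) (r : 'cV[C]_k) :
  \rank Y = k -> cmx Y *m r = 0 -> r = 0.
Proof.
move=> rY Yr; apply: trmx_inj; apply/eqP; rewrite trmx0.
rewrite -(@mulmx_free_eq0 _ _ _ _ _ (cmx Y)^T).
  by rewrite -trmx_mul Yr trmx0.
by rewrite /row_free mxrank_tr mxrank_map rY.
Qed.

Variables (n m : nat) (A : 'M[R]_n) (B : 'M[R]_(n, m)) (G : 'M[R]_(m, n)).
Variables (D : 'M[R]_m) (xi : R) (k : nat) (U V : 'M[R]_(n, k)).
Variables (W : 'M[R]_(m, k)) (M : 'M[R]_k).
Let Axi := A + (xi / 2)%:M.
Let Sxi := D^T + D - xi%:M.

Definition pencil_eqs :=
  [/\ Axi *m V + B *m W = V *m M, Axi^T *m U + G^T *m W = - (U *m M)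
    & B^T *m U + G *m V + Sxi *m W = 0].

Lemma shifted_pencil_eqs :
  (forall s : R,
    shifted_pencil (Model A B G D) xi s *m col_mx U (col_mx V W)
    = col_mx V (col_mx (- U) 0) *m (M - s%:M)) -> pencil_eqs.
Proof.
(* Nothing is lost at s = 0: the terms in s agree on both sides for any U, V, W. *)
move=> /(_ 0); rewrite /shifted_pencil /= !(raddf0, subr0, addr0).
rewrite mul_block_col mul0mx add0r mul_row_col mul_col_mx.
rewrite [block_mx 0 _ _ _ *m _]mul_block_col mul0mx add0r.
rewrite add_col_mx !mul_col_mx => /eq_col_mx[e1 /eq_col_mx[e2 e3]].
split; first exact: e1.
  by rewrite -mulNmx -e2 /Axi linearD /= tr_scalar_mx.
by rewrite -addrA e3 mul0mx.
Qed.

Lemma pencil_eqs_deflating : pencil_eqs ->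
  deflating (cmx Axi) (cmx B) (cmx G) (cmx Sxi) (cmx U) (cmx V) (cmx W) (cmx M).
Proof.
move=> [e1 e2 e3]; split.
- by rewrite -!cmxM -cmxD e1.
- by rewrite !adj_cmx -!cmxM -cmxD e2 cmxN.
- by rewrite !adj_cmx -!cmxM -!cmxD e3 cmx0.
Qed.

Lemma Xi_sup_lt : (xi%:E < Xi_sup (Model A B G D))%E ->
  exists2 xi', xi < xi' & strictly_passive (shift xi' (Model A B G D)).
Proof.
move=> /ereal_sup_gt[_ [xi' sp <-]]; rewrite lte_fin => lt; by exists xi'.
Qed.

Hypothesis UVW : pencil_eqs.
Hypothesis M_spec : forall s : C, eigenvalue (cmx M) s -> 0 < complex.Re s.
Hypothesis UVW_rank : \rank (col_mx U (col_mx V W)) = k.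
Hypothesis AB_controllable : controllable (Model A B G D).
Variables (xi' : R).
Hypothesis xi_lt : xi < xi'.
Hypothesis sp' : strictly_passive (shift xi' (Model A B G D)).

Let X := - (U^T *m V).

(** Strict passivity is available at xi' only; lowering the level to xi adds the positive multiple
    xi' - xi of the identity. *)
Lemma Sxi_pd : pdmx Sxi.
Proof.
have [_ _ /= [ST S0]] := sp'.
have SE : Sxi = (D - (xi' / 2)%:M)^T + (D - (xi' / 2)%:M) + (xi' - xi)%:M.
  by apply/matrixP => i j; rewrite !mxE eq_sym; case: (_ == _); 
     rewrite ?mulr1n ?mulr0n; field.
split=> [|v v0]; first by rewrite SE linearD /= ST tr_scalar_mx.
rewrite SE mulmxDr mulmxDl mxlinE ltr_wpDr ?S0 //.
rewrite mul_mx_scalar -scalemxAl mxlinE mulr_ge0 //.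
  by rewrite subr_ge0 ltW.
by rewrite mxE sumr_ge0 // => i _; rewrite mxE -expr2 sqr_ge0.
Qed.

Lemma Axi_stable a : eigenvalue (cmx Axi) a -> complex.Re a < 0.
Proof.
move=> /eigenvalue_colP[v Av v0].
have [_ st _] := sp'.
have d0 : 0 < (xi' - xi) / 2 by rewrite divr_gt0 // subr_gt0.
have /st : eigenvalue (cmx (mA (shift xi' (Model A B G D))))
    (a + ((xi' - xi) / 2)%:C%C).
  apply/eigenvalue_colP; exists v => //=.
  have -> : A + (xi' / 2)%:M = Axi + ((xi' - xi) / 2)%:M.
    by rewrite /Axi -addrA -raddfD /=; congr (_ + _%:M); field.
  by rewrite cmxD cmx_scalar mulmxDl Av mul_scalar_mx scalerDl.
by rewrite raddfD /= => /(le_lt_trans _); apply; rewrite lerDl ltW.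
Qed.

Lemma gram_pd : pdmx X.
Proof.
apply: hpdmx_cmx.
have def := pencil_eqs_deflating UVW.
have Spd := pdmx_cmx Sxi_pd.
have spec a : eigenvalue (cmx M) a -> 0 < a + a^*.
  by move=> /M_spec; rewrite addCconj_gt0.
have XE : cmx X = - ((cmx U)^H *m cmx V) by rewrite adj_cmx cmxN cmxM.
have XH := deflating_herm def Spd (or_introl spec).
(* Shifting A by c moves eigenvalues and keeps eigenvectors, so one controllability assumption
   serves both levels xi and xi'. *)
have pbh (c : R) (q : 'cV[C]_n) a : (cmx (A + c%:M))^H *m q = a *: q ->
    (cmx B)^H *m q = 0 -> q = 0.
  rewrite adj_cmx linearD /= tr_scalar_mx cmxD cmx_scalar mulmxDl.
  rewrite mul_scalar_mx => qA.
  apply: (@controllable_pbh _ _ _ _ _ (a - c%:C%C) AB_controllable).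
  by rewrite scalerBl -qA addrK adj_cmx.
have [P [L [Ppd eP eG]]] := strictly_passive_lure sp' (pbh _).
pose d : C := ((xi' - xi) / 2)%:C%C.
have Vinj : forall r : 'cV[C]_k, cmx V *m r = 0 -> r = 0.
  apply: (deflating_injV def Spd XH) => // [r Ur Vr Wr|q a]; last exact: pbh.
  apply: (col_rank_inj UVW_rank).
  by rewrite /cmx !map_col_mx !mul_col_mx Ur Vr Wr !col_mx0.
rewrite XE.
have AE : cmx (A + (xi' / 2)%:M) = cmx Axi + d%:M.
  rewrite /d -cmx_scalar -cmxD; congr cmx.
  by rewrite /Axi -addrA -raddfD /=; congr (_ + _%:M); field.
have SE : cmx ((D - (xi' / 2)%:M)^T + (D - (xi' / 2)%:M))
    = cmx Sxi - (d + d)%:M.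
  rewrite /d -rmorphD -cmx_scalar -cmxN -cmxD; congr cmx.
  by apply/matrixP => i j; rewrite !mxE eq_sym; case: (_ == _); 
     rewrite ?mulr1n ?mulr0n; field.
have [_ _ /pdmx_cmx /= S'pd] := sp'.
move: eP eG S'pd; rewrite /= AE SE => eP eG S'pd.
apply: (deflating_gram_pd def spec Vinj XH _ Spd Ppd S'pd eP eG).
by rewrite /d ler0c divr_ge0 // subr_ge0 ltW.
Qed.

End ShiftedPencil.

(** * The reduced model *)

Section Reduced.
Variable R : realType.
Local Notation C := R[i].

Lemma pdmx_psd k (M : 'M[R]_k) : pdmx M -> psdmx M.
Proof.
move=> [MT M0]; split=> // v; have [->|/M0/ltW//] := eqVneq v 0.
by rewrite mulmx0 mxE.
Qed.

Lemma psdmx_congr k l (T : 'M[R]_(k, l)) (M : 'M[R]_k) :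
  psdmx M -> psdmx (T^T *m M *m T).
Proof.
move=> [MT M0]; split=> [|v]; first by rewrite !trmx_mul trmxK MT mulmxA.
by have := M0 (T *m v); rewrite trmx_mul !mulmxA.
Qed.

Lemma pdmx_unit k (M : 'M[R]_k) : pdmx M -> M \in unitmx.
Proof. by move=> /pdmx_cmx/hpdmx_unit; rewrite map_unitmx. Qed.

Lemma pdmx1 k : pdmx (1%:M : 'M[R]_k).
Proof.
by apply: hpdmx_cmx; rewrite cmx_scalar; split=> [|v v0];
  rewrite ?adjmx1 // mulmx1 lt_def sqnorm_ge0 sqnorm_eq0 v0.
Qed.

Lemma pdmx_block_diag k l (M : 'M[R]_k) (N : 'M[R]_l) :
  pdmx M -> pdmx N -> pdmx (block_mx M 0 0 N).
Proof.
move=> Mpd Npd; have [MT M0] := Mpd; have [NT N0] := Npd.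
split=> [|v]; first by rewrite tr_block_mx MT NT !trmx0.
rewrite -[v]vsubmxK; move: (usubmx v) (dsubmx v) => x y xy0.
rewrite tr_col_mx mul_row_block mul_row_col !mulmx0 addr0 add0r mxlinE.
have [x0|x0] := eqVneq x 0; last first.
  by rewrite ltr_wpDr ?M0 //; apply: (pdmx_psd Npd).2.
rewrite ltr_wpDl ?(pdmx_psd Mpd).2 // N0 //.
by apply: contraNneq xy0 => ->; rewrite x0 col_mx0.
Qed.

Lemma pdmxZ k a (M : 'M[R]_k) : 0 < a -> pdmx M -> pdmx (a *: M).
Proof.
move=> a0 [MT M0]; split=> [|v v0]; first by rewrite linearZ /= MT.
by rewrite -scalemxAr -scalemxAl mxlinE mulr_gt0 ?M0.
Qed.

Variables (n m : nat) (A : 'M[R]_n) (B : 'M[R]_(n, m)) (G : 'M[R]_(m, n)).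
Variables (D : 'M[R]_m) (xi : R) (k : nat) (U V : 'M[R]_(n, k)).
Variables (W : 'M[R]_(m, k)) (M : 'M[R]_k).
Let Sxi := D^T + D - xi%:M.
Let X := - (U^T *m V).
Let Ah := invmx (U^T *m V) *m (U^T *m A *m V).
Let Bh := invmx (U^T *m V) *m (U^T *m B).

Hypothesis UVW : pencil_eqs A B G D xi U V W M.
Hypothesis X_pd : pdmx X.
Hypothesis S_pd : pdmx Sxi.

Lemma gram_unit : U^T *m V \in unitmx.
Proof.
have := pdmx_unit X_pd; rewrite /X -scaleN1r unitmxZ ?unitrN1 //.
Qed.

(** Full rank is read off the invertible product U^T V, whose rank bounds neither factor by less
    than k. *)
Lemma rank_UV : \rank U = k /\ \rank V = k.
Proof.
have rk : \rank (U^T *m V) = k by rewrite mxrank_unit ?gram_unit.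
split; apply/eqP; rewrite eqn_leq rank_leq_col -{1}rk.
  by rewrite -(mxrank_tr U) mxrankM_maxl.
exact: mxrankM_maxr.
Qed.

Lemma X_Ah : X *m Ah = - (U^T *m A *m V).
Proof. by rewrite /X /Ah mulNmx mulKVmx ?gram_unit. Qed.

Lemma X_Bh : X *m Bh = - (U^T *m B).
Proof. by rewrite /X /Bh mulNmx mulKVmx ?gram_unit. Qed.

(** The left side is F + F^T for F = U^T (A + xi/2) V. The second pencil equation evaluates F^T, the
    first and third evaluate F, and in the sum the terms in X M and in V^T G^T W cancel. *)
Lemma lmi_ul : - (X *m Ah) - Ah^T *m X - xi *: X = W^T *m Sxi *m W.
Proof.
have [e1 e2 e3] := UVW; have [XT _] := X_pd; have [ST _] := S_pd.
pose F := U^T *m (A + (xi / 2)%:M) *m V.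
have F1 : F^T = X *m M - V^T *m G^T *m W.
  have -> : F^T = V^T *m ((A + (xi / 2)%:M)^T *m U).
    by rewrite /F !trmx_mul trmxK.
  have -> : (A + (xi / 2)%:M)^T *m U = - (U *m M) - G^T *m W.
    by rewrite -e2 addrK.
  have -> : X = - (V^T *m U) by rewrite -XT /X linearN /= trmx_mul trmxK.
  by rewrite mulmxBr mulmxN mulNmx !mulmxA.
have F2 : F = - (X *m M) + V^T *m G^T *m W + W^T *m Sxi *m W.
  have UB : U^T *m B = - (V^T *m G^T) - W^T *m Sxi.
    have := congr1 trmx e3; rewrite -/Sxi linearD linearD /= !trmx_mul trmxK ST.
    by rewrite linear0 -addrA => /eqP; rewrite addr_eq0 opprD => /eqP.
  have AV : (A + (xi / 2)%:M) *m V = V *m M - B *m W by rewrite -e1 addrK.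
  have -> : - (X *m M) = U^T *m V *m M by rewrite /X mulNmx opprK.
  rewrite /F -mulmxA AV mulmxBr !mulmxA UB mulmxBl mulNmx opprB opprK.
  by rewrite -[RHS]addrA [X in _ = _ + X]addrC.
have FE : F = - (X *m Ah) - (xi / 2) *: X.
  rewrite X_Ah opprK /F mulmxDr mulmxDl mul_mx_scalar -scalemxAl.
  by rewrite /X scalerN opprK.
have FT : F^T = - (Ah^T *m X) - (xi / 2) *: X.
  by rewrite FE linearB linearN /= linearZ /= XT trmx_mul XT.
have -> : - (X *m Ah) - Ah^T *m X - xi *: X = F + F^T.
  rewrite FT FE; move: (X *m Ah) (Ah^T *m X) => x y.
  by apply/matrixP => i j; rewrite !mxE; field.
rewrite F1 F2; move: (X *m M) (V^T *m G^T *m W) (W^T *m Sxi *m W) => x y z.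
by apply/matrixP => i j; rewrite !mxE; ring.
Qed.

Lemma lmi_ur : (G *m V)^T - X *m Bh = - (W^T *m Sxi).
Proof.
have [e1 e2 e3] := UVW; have [ST _] := S_pd.
rewrite X_Bh opprK trmx_mul addrC; apply/eqP; rewrite -addr_eq0; apply/eqP.
have := congr1 trmx e3; rewrite -/Sxi linearD linearD /= !trmx_mul trmxK ST.
by rewrite linear0.
Qed.

Lemma lmi_gram :
  block_mx (- (X *m Ah) - Ah^T *m X) ((G *m V)^T - X *m Bh)
           (G *m V - Bh^T *m X) (D^T + D) - xi *: block_mx X 0 0 1%:M
  = (row_mx W (- 1%:M))^T *m Sxi *m row_mx W (- 1%:M).
Proof.
have [XT _] := X_pd; have [ST _] := S_pd.
have lmi_dl : G *m V - Bh^T *m X = - (Sxi *m W).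
  apply: trmx_inj; rewrite linearB /= [(Bh^T *m X)^T]trmx_mul XT trmxK lmi_ur.
  by rewrite linearN /= trmx_mul ST.
rewrite scale_block_mx !scaler0 opp_block_mx add_block_mx !oppr0 !addr0.
rewrite lmi_ul lmi_ur lmi_dl tr_row_mx mul_col_mx mul_col_row.
have -> : (- 1%:M : 'M[R]_m)^T = - 1%:M by rewrite linearN /= trmx1.
by rewrite !mulNmx !mulmxN mul1mx !mulmx1 opprK scalemx1.
Qed.

(** The upper left block of the matrix inequality, evaluated at an eigenvector, gives the bound. It
    keeps the points sigma - xi/2 away from the poles of the reduced model. *)
Lemma Ah_spec a : eigenvalue (cmx Ah) a -> complex.Re a <= - (xi / 2).
Proof.
move=> /eigenvalue_colP[v Av v0].
have XC := pdmx_cmx X_pd.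
have := (hpsdmx_congr (cmx W) (psdmx_cmx (pdmx_psd S_pd))).2 v.
rewrite [(cmx W)^H]adj_cmx -!cmxM -lmi_ul.
have cmxE (Y Z : 'M[R]_k) : cmx (- (Y *m Z) - Z^T *m Y - xi *: Y) =
   - (cmx Y *m cmx Z) - (cmx Z)^H *m cmx Y - (xi%:C)%C *: cmx Y.
  rewrite !(cmxD, cmxN, cmxM) adj_cmx; congr (_ - _).
  exact: map_mxZ.
rewrite cmxE; move: (X) (Ah) Av XC => Y Z Zv XC.
have YZ : v^H *m (cmx Y *m cmx Z) *m v = a *: (v^H *m cmx Y *m v).
  by rewrite mulmxA -mulmxA Zv -scalemxAr.
have ZY : v^H *m ((cmx Z)^H *m cmx Y) *m v = a^* *: (v^H *m cmx Y *m v).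
  by rewrite mulmxA -adjmxM Zv adjmxZ -!scalemxAl.
have xY : v^H *m ((xi%:C)%C *: cmx Y) *m v
    = (xi%:C)%C *: (v^H *m cmx Y *m v).
  by rewrite -scalemxAr -scalemxAl.
move: YZ ZY xY (XC.2 v v0).
move: (cmx Y *m cmx Z) ((cmx Z)^H *m cmx Y) (_ *: cmx Y).
move=> Y1 Y2 Y3 E1 E2 E3 q0.
rewrite !mulmxBr !mulmxBl mulmxN mulNmx E1 E2 E3 !mxlinE.
move: ((v^H *m cmx Y *m v) 0 0) q0 => q q0.
have -> : - (a * q) - a^* * q - (xi%:C)%C * q = - (a + a^* + (xi%:C)%C) * q.
  by ring.
rewrite pmulr_lge0 // oppr_ge0 addCconj -rmorphD /= lecR => h; lra.
Qed.

End Reduced.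

(** * The value at infinity *)

Section Infinity.
Local Open Scope classical_set_scope.
Variable R : realType.
Local Notation C := R[i].

Lemma continuous_horner_num (K : numFieldType) (p : {poly K}) :
  continuous (horner p).
Proof.
elim/poly_ind: p => [|p c IH] x.
  rewrite (_ : horner 0 = cst 0); last by apply/funext => y; rewrite horner0.
  exact: cst_continuous.
rewrite (_ : horner _ = (horner p \* id) \+ cst c); last first.
  by apply/funext => y; rewrite hornerMXaddC.
have h : (horner p \* id) y @[y --> x] --> p.[x] * x.
  exact: (@cvgM _ _ (nbhs x) _ _ _ _ _ (IH x) cvg_id).
exact: (@cvgD _ _ _ (nbhs x) _ _ _ _ _ h (cvg_cst _)).
Qed.

Lemma cvg_at0_rational (K : numFieldType) (p q : {poly K}) (d : K)
    (g : K -> K) :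
  p.[0] != 0 ->
  (forall t, t != 0 -> p.[t] != 0 -> g t = t * (q.[t] / p.[t]) + d) ->
  (fun t : K^o => g t : K^o) @ (0 : K^o)^' --> (d : K^o).
Proof.
move=> p0 gE; have FF : Filter (nbhs (0 : K)) := nbhs_filter _.
have q0 := @continuous_horner_num _ q 0.
have p0' := @continuous_horner_num _ p 0.
have h1 := cvgV (FF := FF) p0 p0'.
have h2 := cvgM (FF := FF) q0 h1.
have h3 := cvgM (FF := FF) cvg_id h2.
have h4 := cvgD (FF := FF) h3
  (@cvg_cst _ d _ (nbhs (0 : K)) FF).
rewrite mul0r add0r in h4.
have h5 := @cvg_within_filter _ _ _ (nbhs (0 : K)) FF _ [set t : K | t != 0] h4.
apply: cvg_trans h5.

apply: near_eq_cvg.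
have := @cvgr_neq0 _ _ _ (nbhs (0 : K)) FF _ _ p0' p0.
by rewrite /within /=; apply: filterS => t pt t0; rewrite gE.
Qed.

(** In the chart at infinity the resolvent is t (1 - t A)^-1, that is t times adjugate over
    determinant: polynomials in t, with denominator 1 at t = 0. *)
Lemma tf_at_infty_mD n m (M : model R n m) : tf_at_infty M (mD M).
Proof.
case: M => A B G D i j; rewrite /tf /=.
pose N : 'M[{poly C}]_n := 1%:M - 'X *: map_mx polyC (cmx A).
pose p := \det N.
pose q := (map_mx polyC (cmx G) *m \adj N *m map_mx polyC (cmx B)) i j.
have evalC a b (K : 'M[C]_(a, b)) t :
    map_mx (horner_eval t) (map_mx polyC K) = K.
  by apply/matrixP => x y; rewrite !mxE; apply: hornerC.
have evalN t : map_mx (horner_eval t) N = 1%:M - t *: cmx A.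
  rewrite /N map_mxB map_mx1 map_mxZ evalC; congr (_ - _ *: _).
  exact: hornerX.
have pE t : p.[t] = \det (1%:M - t *: cmx A).
  by rewrite -[LHS]/(horner_eval t p) /p -det_map_mx evalN.
have qE t : q.[t] = (cmx G *m \adj (1%:M - t *: cmx A) *m cmx B) i j.
  rewrite -[LHS]/(horner_eval t q) /q.
  have -> (K : 'M[{poly C}]_m) :
      horner_eval t (K i j) = (map_mx (horner_eval t) K) i j.
    by rewrite mxE.
  by rewrite !map_mxM !evalC map_mx_adj evalN.
have p0 : p.[0] = 1 by rewrite pE scale0r subr0 det1.
have tfE (t : C) : t != 0 -> p.[t] != 0 ->
    (cmx G *m invmx ((t^-1)%:M - cmx A) *m cmx B + cmx D) i j
    = t * (q.[t] / p.[t]) + cmx D i j.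
  move=> t0 pt; rewrite addmxE; congr (_ + _).
  have -> : (t^-1)%:M - cmx A = t^-1 *: (1%:M - t *: cmx A).
    by rewrite scalerBr scalemx1 scalerA mulVf // scale1r.
  have Nu : 1%:M - t *: cmx A \in unitmx by rewrite unitmxE -pE unitfE.
  rewrite invmxZ ?unitmxZ ?unitfE ?invr_eq0 // invrK /invmx Nu -pE.
  rewrite -!scalemxAr -!scalemxAl !scalemxE -qE; ring.
by apply: (cvg_at0_rational _ tfE); rewrite p0 oner_eq0.
Qed.

End Infinity.

(** * Interpolation *)

Section Interpolation.
Variable R : realType.
Local Notation C := R[i].

Lemma cmx_tr a b (N : 'M[R]_(a, b)) : cmx N^T = (cmx N)^T.
Proof. by rewrite /cmx map_trmx. Qed.

Variables (n m : nat) (A : 'M[R]_n) (B : 'M[R]_(n, m)) (G : 'M[R]_(m, n)).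
Variables (D : 'M[R]_m) (xi : R) (k : nat) (U V : 'M[R]_(n, k)).
Variables (W : 'M[R]_(m, k)) (M : 'M[R]_k).
Let Ah := invmx (U^T *m V) *m (U^T *m A *m V).
Let Bh := invmx (U^T *m V) *m (U^T *m B).
Let Mo := Model A B G D.
Let Mh := Model Ah Bh (G *m V) D.

Hypothesis UVW : pencil_eqs A B G D xi U V W M.
Hypothesis UV_unit : U^T *m V \in unitmx.
Variables (sigma : C) (r : 'cV[C]_k).
Hypothesis Mr : cmx M *m r = sigma *: r.
Let sp := sigma - (xi / 2)%:C%C.
Let sm := - sigma - (xi / 2)%:C%C.

(** For the input W r the full model has state V r, by the first pencil equation, and its projection
    by U^T shows that the reduced model has state r. The outputs C V r + D W r coincide. *)
Lemma right_interpolation : regular_at Mo sp -> regular_at Mh sp ->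
  tf Mo sp *m cmx W *m r = tf Mh sp *m cmx W *m r.
Proof.
rewrite /regular_at /tf /= => reg regh.
have [e1 _ _] := UVW.
have spA : (sp%:M - cmx A) *m (cmx V *m r) = cmx B *m cmx W *m r.
  have := congr1 (fun N => cmx N *m r) e1.
  rewrite cmxD !cmxM cmxD cmx_scalar 2!mulmxDl mulmxDl.
  rewrite -![_ *m _ *m r]mulmxA Mr !mul_scalar_mx -scalemxAr => e.
  rewrite mulmxBl mul_scalar_mx /sp scalerBl -e.
  move: (cmx A *m _) (_ *: _) (cmx B *m _) => x y z.
  by apply/matrixP => i j; rewrite !mxE; ring.
have spAh : (sp%:M - cmx Ah) *m r = cmx Bh *m cmx W *m r.
  have UVu : cmx (U^T *m V) \in unitmx by rewrite map_unitmx.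
  apply: (can_inj (mulKmx UVu)).
  rewrite mulmxBl mulmxBr mul_scalar_mx -scalemxAr !mulmxA -!cmxM.
  rewrite /Ah /Bh !(mulKVmx UV_unit).
  have := congr1 (mulmx (cmx U^T)) spA.
  by rewrite mulmxBl mulmxBr mul_scalar_mx -scalemxAr !mulmxA -!cmxM.
rewrite !mulmxDl; congr (_ + _).
rewrite -!mulmxA !(mulmxA _ (cmx W) r) -spA -spAh !mulKmx //.
by rewrite cmxM mulmxA.
Qed.

(** Dually, the second pencil equation makes r^T U^T the row state of the full model for the
    covector r^T W^T, and multiplying it by V gives that of the reduced one. *)
Lemma left_interpolation : regular_at Mo sm -> regular_at Mh sm ->
  r^T *m (cmx W)^T *m tf Mo sm = r^T *m (cmx W)^T *m tf Mh sm.
Proof.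
rewrite /regular_at /tf /= => reg regh.
have [_ e2 _] := UVW.
have UA : r^T *m (cmx U)^T *m (sm%:M - cmx A) = r^T *m (cmx W)^T *m cmx G.
  have := congr1 (fun N => (cmx N *m r)^T) e2.
  rewrite cmxD cmxN !cmxM !cmx_tr cmxD cmx_scalar mulmxDl mulNmx.
  rewrite -[_ *m cmx M *m r]mulmxA Mr -scalemxAr linearN linearD /= !trmx_mul.
  rewrite linearZ /= !trmx_mul !trmxK mulmxDr mul_mx_scalar mulmxDr.
  rewrite -scalemxAr mulmxBr mul_mx_scalar !mulmxA /sm scalerBl scaleNr => <-.
  move: (_ *m cmx A) (_ *: _) (_ *m cmx G) => x y z.
  by apply/matrixP => i j; rewrite !mxE; ring.
have YA : r^T *m cmx (U^T *m V) *m (sm%:M - cmx Ah)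
    = r^T *m (cmx W)^T *m cmx (G *m V).
  rewrite [cmx (G *m V)]cmxM mulmxA -UA mulmxBr mulmxBr mulmxBl !mul_mx_scalar.
  rewrite -!scalemxAl -!mulmxA -!cmxM /Ah (mulKVmx UV_unit).
  by rewrite -cmx_tr -!cmxM !mulmxA.
rewrite !mulmxDr; congr (_ + _).
rewrite !mulmxA -UA -YA !mulmxK //.
by rewrite -!mulmxA -cmxM /Bh (mulKVmx UV_unit) cmxM /cmx map_trmx.
Qed.

End Interpolation.

(** * Matrix norms *)

Section Norms.
Local Open Scope classical_set_scope.
Variable R : realType.

Lemma frobenius_norm_ge0 k l (M : 'M[R]_(k, l)) : 0 <= frobenius_norm M.
Proof. exact: sqrtr_ge0. Qed.

Lemma sqr_frobenius_norm k l (M : 'M[R]_(k, l)) :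
  frobenius_norm M ^+ 2 = \sum_i \sum_j M i j ^+ 2.
Proof.
rewrite sqr_sqrtr // sumr_ge0 // => i _.
by rewrite sumr_ge0 // => j _; exact: sqr_ge0.
Qed.

Lemma sqr_frobenius_norm_col k (v : 'cV[R]_k) :
  frobenius_norm v ^+ 2 = (v^T *m v) 0 0.
Proof.
rewrite sqr_frobenius_norm mxE; apply: eq_bigr => i _.
by rewrite big_ord1 mxE expr2.
Qed.

Lemma frobenius_norm_eq0 k (v : 'cV[R]_k) : (frobenius_norm v == 0) = (v == 0).
Proof.
apply/idP/eqP => [|->]; last first.
  by rewrite -sqrf_eq0 sqr_frobenius_norm_col mulmx0 mxE.
rewrite -sqrf_eq0 sqr_frobenius_norm psumr_eq0 => [/allP h|i _]; last first.
  by rewrite sumr_ge0 // => j _; exact: sqr_ge0.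
apply/colP => i; have := h i (mem_index_enum i); rewrite big_ord1 /= sqrf_eq0.
by rewrite mxE => /eqP.
Qed.

Lemma frobenius_norm_gt0 k (v : 'cV[R]_k) : (0 < frobenius_norm v) = (v != 0).
Proof. by rewrite lt_def frobenius_norm_eq0 frobenius_norm_ge0 andbT. Qed.

Lemma frobenius_norm0 k : frobenius_norm (0 : 'cV[R]_k) = 0.
Proof. by apply/eqP; rewrite frobenius_norm_eq0. Qed.

Lemma frobenius_normZ k (v : 'cV[R]_k) a :
  frobenius_norm (a *: v) = `|a| * frobenius_norm v.
Proof.
apply/eqP; rewrite -(eqrXn2 (n := 2)) ?mulr_ge0 ?frobenius_norm_ge0 //.
rewrite exprMn !sqr_frobenius_norm_col real_normK ?num_real //.
rewrite [(a *: v)^T]linearZ /=.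
by rewrite -scalemxAl -scalemxAr !scalemxE mulrA expr2.
Qed.

Lemma cauchy_schwarz_col k (u v : 'cV[R]_k) :
  `|(u^T *m v) 0 0| <= frobenius_norm u * frobenius_norm v.
Proof.
rewrite -(ler_pXn2r (n := 2)) ?nnegrE ?mulr_ge0 ?frobenius_norm_ge0 //.
rewrite exprMn real_normK ?num_real //.
set b := frobenius_norm v ^+ 2; set c := (u^T *m v) 0 0.
have [v0|v0] := eqVneq v 0.
  by rewrite /c v0 mulmx0 mxE expr0n /= mulr_ge0 ?sqr_ge0.
have b0 : 0 < b by rewrite exprn_gt0 // frobenius_norm_gt0.
(* This square equals b (a b - c^2), where a and b are the squared norms of u and v. *)
have : 0 <= frobenius_norm (b *: u - c *: v) ^+ 2 by exact: sqr_ge0.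
have cE : (v^T *m u) 0 0 = c by rewrite -[v^T *m u]trmxK trmx_mul trmxK mxE.
rewrite sqr_frobenius_norm_col [(_ - _)^T]linearB /= [(b *: u)^T]linearZ /=.
rewrite [(c *: v)^T]linearZ /= mulmxBl !mulmxBr.
rewrite -!scalemxAl -!scalemxAr !mxlinE cE -/c -!sqr_frobenius_norm_col -/b.
set a := frobenius_norm u ^+ 2.
match goal with |- is_true (0 <= ?x) -> _ =>
  have -> : x = b * (a * b - c ^+ 2) by ring end.
by rewrite pmulr_rge0 // subr_ge0.
Qed.

Lemma frobenius_normM k l (M : 'M[R]_(k, l)) (v : 'cV[R]_l) :
  frobenius_norm (M *m v) <= frobenius_norm M * frobenius_norm v.
Proof.
rewrite -(ler_pXn2r (n := 2)) ?nnegrE ?mulr_ge0 ?frobenius_norm_ge0 //.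
rewrite exprMn !(sqr_frobenius_norm (M *m v), sqr_frobenius_norm M) mulr_suml.
apply: ler_sum => i _; rewrite big_ord1.
have -> : \sum_j M i j ^+ 2 = frobenius_norm (row i M)^T ^+ 2.
  by rewrite sqr_frobenius_norm; apply: eq_bigr => j _; rewrite big_ord1 !mxE.
have -> : (M *m v) i 0 = (((row i M)^T)^T *m v) 0 0.
  by rewrite trmxK -row_mul [RHS]mxE.
rewrite -exprMn -[leLHS](real_normK (num_real _)).
by rewrite ler_pXn2r ?nnegrE ?mulr_ge0 ?frobenius_norm_ge0 ?cauchy_schwarz_col.
Qed.

Let S k l (M : 'M[R]_(k, l)) := [set frobenius_norm (M *m v) | v in
        [set v : 'cV[R]_l | frobenius_norm v <= 1]].

(** The supremum defining [spectral_norm] is meaningful only for a nonempty set bounded above. *)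
Lemma spectral_set_ub k l (M : 'M[R]_(k, l)) : ubound (S M) (frobenius_norm M).
Proof.
move=> _ [v /= v1 <-]; apply: le_trans (frobenius_normM _ _) _.
by rewrite ler_piMr ?frobenius_norm_ge0.
Qed.

Lemma spectral_set_ne k l (M : 'M[R]_(k, l)) : S M !=set0.
Proof.
exists (frobenius_norm (M *m (0 : 'cV_l))); exists 0 => //=.
by rewrite frobenius_norm0.
Qed.

Lemma spectral_norm_le k l (M : 'M[R]_(k, l)) :
  spectral_norm M <= frobenius_norm M.
Proof.
by apply: ge_sup; [exact: spectral_set_ne | exact: spectral_set_ub].
Qed.

Lemma spectral_normM k l (M : 'M[R]_(k, l)) (v : 'cV[R]_l) :
  frobenius_norm (M *m v) <= spectral_norm M * frobenius_norm v.
Proof.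
have [->|v0] := eqVneq v 0.
  by rewrite mulmx0 !frobenius_norm0 mulr0.
have a0 : 0 < frobenius_norm v by rewrite frobenius_norm_gt0.
rewrite -ler_pdivrMr //.
have nE : `|(frobenius_norm v)^-1| = (frobenius_norm v)^-1.
  by rewrite ger0_norm // invr_ge0 ltW.
have -> : frobenius_norm (M *m v) / frobenius_norm v =
    frobenius_norm (M *m ((frobenius_norm v)^-1 *: v)).
  by rewrite -scalemxAr frobenius_normZ nE mulrC.
apply: ub_le_sup; first by exists (frobenius_norm M); exact: spectral_set_ub.
exists ((frobenius_norm v)^-1 *: v) => //=.
by rewrite frobenius_normZ nE mulVf // gt_eqF.
Qed.

End Norms.

(** * The passivity radius *)

Section Passivity.
Local Open Scope classical_set_scope.
Variable R : realType.
Local Notation C := R[i].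

(** The passivity inequality with the identity as certificate. For a normalized port-Hamiltonian
    model it is twice the block matrix of R, P, S. *)
Definition supply_mx n m (M : model R n m) : 'M[R]_(n + m) :=
  block_mx (- mA M - (mA M)^T) ((mC M)^T - mB M)
           (mC M - (mB M)^T) ((mD M)^T + mD M).

Lemma supply_cmx n m (M : model R n m) : cmx (supply_mx M) =
  block_mx (- cmx (mA M) - (cmx (mA M))^H) ((cmx (mC M))^H - cmx (mB M))
           (cmx (mC M) - (cmx (mB M))^H) ((cmx (mD M))^H + cmx (mD M)).
Proof.
by rewrite /supply_mx {1}/cmx map_block_mx !adj_cmx -!cmxN -!cmxD.
Qed.

(** Energy balance at an imaginary frequency: the storage terms cancel because a + conj(a) = 0,
    leaving the supplied power u^H y + y^H u. *)
Lemma supply_form n m (M : model R n m) (x : 'cV[C]_n) (u : 'cV[C]_m) a :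
  a + a^* = 0 -> (a%:M - cmx (mA M)) *m x = cmx (mB M) *m u ->
  ((col_mx x u)^H *m cmx (supply_mx M) *m col_mx x u)
  = u^H *m (cmx (mC M) *m x + cmx (mD M) *m u)
    + (cmx (mC M) *m x + cmx (mD M) *m u)^H *m u.
Proof.
case: M => A B G D /= a0 xE.
have xBu : x^H *m cmx B *m u = a *: (x^H *m x) - x^H *m cmx A *m x.
  by rewrite -mulmxA -xE mulmxA mulmxBr mulmxBl mul_mx_scalar -scalemxAl.
have uBx : u^H *m (cmx B)^H *m x = a^* *: (x^H *m x) - x^H *m (cmx A)^H *m x.
  have := congr1 (fun N => N^H) xBu.
  rewrite adjmxD adjmxN adjmxZ !adjmxM !adjmxK !mulmxA; exact.
rewrite supply_cmx /= adj_col_mx mul_row_block mul_row_col.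
rewrite !adjmxD !adjmxM !(mulmxDl, mulmxDr, mulmxN, mulNmx) !mulmxA xBu uBx.
have -> : a^* = - a by apply/eqP; rewrite -addr_eq0 addrC a0.
rewrite scaleNr.
move: (x^H *m cmx A *m x) (x^H *m (cmx A)^H *m x) (a *: _) => x1 x2 x3.
move: (u^H *m cmx G *m x) (x^H *m (cmx G)^H *m u) => x4 x5.
move: (u^H *m cmx D *m u) (u^H *m (cmx D)^H *m u) => x6 x7.
by apply/matrixP => i j; rewrite !mxE; ring.
Qed.

Lemma tf_conj n m (M : model R n m) s : map_mx Num.conj (tf M s) = tf M s^*.
Proof.
have cmxC a b (N : 'M[R]_(a, b)) : map_mx Num.conj (cmx N) = cmx N.
  by rewrite -[LHS]trmxK map_trmx adj_cmx cmx_tr trmxK.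
by rewrite /tf map_mxD !map_mxM map_invmx map_mxB map_scalar_mx !cmxC.
Qed.

(** Vectors (v, 0) with v an eigenvector of A give strict stability, so the residue condition is
    vacuous; vectors (x, u) with x the state driven by u give the sign of Phi. *)
Lemma pd_supply_passive n m (M : model R n m) : pdmx (supply_mx M) -> passive M.
Proof.
move=> Kpd; have Kc := pdmx_cmx Kpd.
have stab s : eigenvalue (cmx (mA M)) s -> complex.Re s < 0.
  move=> /eigenvalue_colP[v Av v0].
  have v0' : col_mx v (0 : 'cV[C]_m) != 0.
    by rewrite col_mx_eq0 negb_and v0.
  have := Kc.2 _ v0'.
  rewrite supply_cmx adj_col_mx adjmx0 mul_row_block mul_row_col.
  rewrite !mul0mx !mulmx0 !addr0 mulmxDr mulmxDl !mulmxN !mulNmx -mulmxA Av.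
  rewrite -adjmxM Av adjmxZ -scalemxAr -scalemxAl !mxlinE -opprD -mulrDl.
  rewrite -mulNr pmulr_lgt0; first by rewrite oppr_gt0 addCconj_lt0.
  by rewrite lt_def sqnorm_ge0 sqnorm_eq0 v0.
have reg w : regular_at M (0 +i* w)%C.
  rewrite /regular_at eigenvalue_unitmx; apply/negP => /stab /=.
  by rewrite ltxx.
split=> [w rw|s /stab s0|w /stab /=]; last by rewrite ltxx.
- set a := (0 +i* w)%C.
  have aC : a^* = - a by apply/eqP; rewrite eq_complex /= oppr0 !eqxx.
  have a0 : a + a^* = 0 by rewrite aC subrr.
  have tfN : (tf M (- a))^T = (tf M a)^H by rewrite -aC -tf_conj map_trmx.
  have PhiE : Phi M a = (tf M a)^H + tf M a by rewrite /Phi tfN.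
  rewrite PhiE; split=> [|u]; first by rewrite adjmxD adjmxK addrC.
  pose x := invmx (a%:M - cmx (mA M)) *m (cmx (mB M) *m u).
  have xE : (a%:M - cmx (mA M)) *m x = cmx (mB M) *m u.
    by rewrite /x mulKVmx //; exact: reg.
  have := (hpdmx_psd Kc).2 (col_mx x u); rewrite (supply_form a0 xE).
  have -> : cmx (mC M) *m x + cmx (mD M) *m u = tf M a *m u.
    by rewrite /x /tf mulmxDl !mulmxA.
  by rewrite mulmxDr mulmxDl adjmxM !mulmxA addrC.
- split; first exact: ltW.
  by move=> s1; rewrite s1 ltxx in s0.
Qed.

(** Stated for any [nrm] above the spectral norm, which covers both norms: a perturbation of norm
    below c leaves the supply matrix positive definite. *)
Lemma passivity_radius_ge n m (J Rh : 'M[R]_n) (G P : 'M[R]_(n, m))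
    (N S : 'M[R]_m) (c : R) (nrm : 'M[R]_(n + m) -> R) :
  normalized_pH J Rh G P N S ->
  (forall v : 'cV[R]_(n + m),
    c * frobenius_norm v ^+ 2 <= (v^T *m block_mx Rh P P^T S *m v) 0 0) ->
  (forall M, spectral_norm M <= nrm M) ->
  (c%:E <= passivity_radius nrm (Model (J - Rh) (G - P) (G + P)^T (N + S)))%E.
Proof.
move=> [JT NT [RS _]] Rc nrm_ge.
apply: le_ereal_inf_tmp => _ [Delta /= np <-]; rewrite lee_fin leNgt.
apply/negP => lt; apply: np; apply: pd_supply_passive.
(* A and B enter the supply matrix with a minus sign. The signature matrix [T] absorbs it, so that
   Delta contributes T Delta plus its transpose, and [T] preserves Euclidean norms. *)
pose T : 'M[R]_(n + m) := block_mx (- 1%:M) 0 0 1%:M.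
have TT : T^T = T.
  by rewrite /T tr_block_mx linearN /= !trmx1 !trmx0.
have T2 : T *m T = 1%:M.
  rewrite /T mulmx_block !mulmx0 !mul0mx !addr0 add0r mulNmx mulmxN opprK.
  by rewrite !mulmx1 scalar_mx_block.
have frobT (v : 'cV_(n + m)) : frobenius_norm (T *m v) = frobenius_norm v.
  apply/eqP; rewrite -(eqrXn2 (n := 2)) ?frobenius_norm_ge0 //.
  rewrite !sqr_frobenius_norm_col trmx_mul TT -mulmxA (mulmxA T) T2 mul1mx.
  by [].
have -> : supply_mx (perturb (Model (J - Rh) (G - P) (G + P)^T (N + S)) Delta)
    = 2 *: block_mx Rh P P^T S + (T *m Delta + (T *m Delta)^T).
  have := RS; rewrite tr_block_mx trmxK => /eq_block_mx[RhT _ _ ST].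
  have -> : T *m Delta = block_mx (- ulsubmx Delta) (- ursubmx Delta)
                                  (dlsubmx Delta) (drsubmx Delta).
    rewrite -{1}[Delta]submxK /T mulmx_block !mul0mx !addr0 !add0r !mulNmx.
    by rewrite !mul1mx.
  rewrite tr_block_mx scale_block_mx !add_block_mx /supply_mx /=.
  move: (ulsubmx Delta) (ursubmx Delta) (dlsubmx Delta) (drsubmx Delta).
  move=> x y z t.
  congr block_mx; rewrite !(linearD, linearN) /= ?trmxK ?JT ?NT ?RhT ?ST.
  - by move: x^T => x'; apply/matrixP => i j; rewrite !mxE; ring.
  - by move: z^T => z'; apply/matrixP => i j; rewrite !mxE; ring.
  - by move: y^T G^T P^T => y' G' P'; apply/matrixP => i j; rewrite !mxE; ring.
  - by move: t^T => t'; apply/matrixP => i j; rewrite !mxE; ring.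
split=> [|v v0].
  by rewrite !linearD /= linearZ /= RS trmxK [(_ *m _)^T + _]addrC.
have vE : (v^T *m (T *m Delta)^T *m v) 0 0 = (v^T *m (T *m Delta) *m v) 0 0.
  have -> : v^T *m (T *m Delta)^T *m v = (v^T *m (T *m Delta) *m v)^T.
    by rewrite [RHS]trmx_mul [X in _ = _ *m X]trmx_mul trmxK mulmxA.
  by rewrite [LHS]mxE.
rewrite mulmxDr mulmxDl mulmxDr mulmxDl -scalemxAr -scalemxAl !mxlinE vE.
have f0 : 0 < frobenius_norm v by rewrite frobenius_norm_gt0.
have := Rc v; set q := (v^T *m block_mx _ _ _ _ *m v) 0 0 => Rcv.
have h : `|(v^T *m (T *m Delta) *m v) 0 0|
    <= spectral_norm Delta * frobenius_norm v ^+ 2.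
  have -> : v^T *m (T *m Delta) *m v = (T *m v)^T *m (Delta *m v).
    by rewrite trmx_mul TT !mulmxA.
  apply: le_trans (cauchy_schwarz_col _ _) _; rewrite frobT.
  by rewrite mulrC expr2 mulrA ler_wpM2r ?frobenius_norm_ge0 // spectral_normM.
have lt' : spectral_norm Delta * frobenius_norm v ^+ 2
    < c * frobenius_norm v ^+ 2.
  by rewrite ltr_pM2r ?exprn_gt0 // (le_lt_trans (nrm_ge _)).
move: h; rewrite ler_norml => /andP[h _].
lra.
Qed.

End Passivity.

(** The coordinates T turn the certificate X into the identity, so the bound xi diag(X, I) becomes
    the bound xi for twice the port-Hamiltonian matrix; this is the origin of xi/2. *)
Lemma lmi_normalized_pH (R : realType) (k m : nat) (A : 'M[R]_k)
    (B : 'M[R]_(k, m)) (G : 'M[R]_(m, k)) (D : 'M[R]_m) (X T : 'M[R]_k)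
    (xi : R) :
  pdmx X -> X = T^T *m T -> 0 <= xi ->
  psdmx (block_mx (- (X *m A) - A^T *m X) (G^T - X *m B)
                  (G - B^T *m X) (D^T + D) - xi *: block_mx X 0 0 1%:M) ->
  exists (J Rh : 'M[R]_k) (G' P : 'M[R]_(k, m)) (N S : 'M[R]_m),
    [/\ block_mx T 0 0 1%:M *m block_mx A B G D *m block_mx (invmx T) 0 0 1%:M
        = block_mx (J - Rh) (G' - P) (G' + P)^T (N + S),
        normalized_pH J Rh G' P N S &
        forall v : 'cV[R]_(k + m), xi / 2 * frobenius_norm v ^+ 2
          <= (v^T *m block_mx Rh P P^T S *m v) 0 0].
Proof.
move=> Xpd XT xi0 lmi; have [XH _] := Xpd.
have Tu : T \in unitmx.
  by have := pdmx_unit Xpd; rewrite XT unitmx_mul => /andP[].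
set K := block_mx (- _ - _) _ _ _ in lmi.
pose F := T *m A *m invmx T; pose B' := T *m B; pose C' := G *m invmx T.
pose h : R := 2^-1.
have half k1 k2 (M : 'M[R]_(k1, k2)) : h *: (M + M) = M.
  by apply/matrixP => i j; rewrite !mxE /h; field.
(* Forced choices: skew and symmetric parts of the transformed A and D, and half sum and half
   difference of the transformed C^T and B. *)
exists (h *: (F - F^T)), (- (h *: (F + F^T))), (h *: (C'^T + B')).
exists (h *: (C'^T - B')), (h *: (D - D^T)), (h *: (D + D^T)).
set Rm := block_mx (- (h *: (F + F^T))) _ _ _.
pose Q : 'M[R]_(k + m) := block_mx (invmx T) 0 0 1%:M.
have TiT : (invmx T)^T *m T^T = 1%:M by rewrite -trmx_mul mulmxV // trmx1.
have RmE : Rm = h *: (Q^T *m K *m Q).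
  rewrite /Rm /K /Q tr_block_mx trmx1 !trmx0 !mulmx_block.
  rewrite !(mulmx0, mul0mx, mulmx1, mul1mx, addr0, add0r) scale_block_mx XT.
  have e1 : (invmx T)^T *m (T^T *m T *m A) *m invmx T = F.
    by rewrite !mulmxA TiT mul1mx.
  have e2 : (invmx T)^T *m (A^T *m (T^T *m T)) *m invmx T = F^T.
    by rewrite /F !trmx_mul -!mulmxA mulmxV // mulmx1.
  have e3 : (invmx T)^T *m (T^T *m T *m B) = B'.
    by rewrite !mulmxA TiT mul1mx.
  have e4 : B^T *m (T^T *m T) *m invmx T = B'^T.
    by rewrite /B' trmx_mul -!mulmxA mulmxV // mulmx1.
  congr block_mx.
  - by rewrite mulmxBr mulmxBl mulmxN mulNmx e1 e2 -opprD scalerN.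
  - by rewrite mulmxBr e3 /C' trmx_mul.
  - by rewrite mulmxBl e4 linearZ /= linearB /= trmxK.
  - by rewrite addrC.
have KE : Q^T *m K *m Q = Q^T *m (K - xi *: block_mx X 0 0 1%:M) *m Q + xi%:M.
  rewrite mulmxBr mulmxBl -scalemxAr -scalemxAl.
  have -> : Q^T *m block_mx X 0 0 1%:M *m Q = 1%:M.
    rewrite /Q tr_block_mx trmx1 !trmx0 !mulmx_block.
    rewrite !(mulmx0, mul0mx, mulmx1, mul1mx, addr0, add0r) XT.
    by rewrite !mulmxA TiT mul1mx mulmxV // -scalar_mx_block.
  by rewrite scalemx1 subrK.
have [QT Q0] := psdmx_congr Q lmi.
have RmT : Rm^T = Rm.
  by rewrite RmE KE linearZ /= linearD /= QT tr_scalar_mx.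
have Rm_ge (v : 'cV[R]_(k + m)) :
    xi / 2 * frobenius_norm v ^+ 2 <= (v^T *m Rm *m v) 0 0.
  rewrite RmE KE -scalemxAr -scalemxAl mulmxDr mulmxDl mul_mx_scalar -scalemxAl.
  rewrite !mxlinE -sqr_frobenius_norm_col.
  have := Q0 v; set q := (v^T *m _ *m v) 0 0; set f := _ ^+ 2 => q0.
  by rewrite /h; lra.
split.
- rewrite !mulmx_block !(mulmx0, mul0mx, mulmx1, mul1mx, addr0, add0r).
  congr block_mx.
  + by rewrite opprK -scalerDr addrACA addNr addr0 half.
  + by rewrite -scalerBr opprB addrC addrA subrK half.
  + by rewrite -scalerDr addrACA subrr addr0 half trmxK.
  + by rewrite -scalerDr addrACA addNr addr0 half.
- split=> //.
  + by rewrite linearZ /= linearB /= trmxK -scalerN opprB.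
  + by rewrite linearZ /= linearB /= trmxK -scalerN opprB.
  + split=> // v; apply: le_trans (Rm_ge v).
    by rewrite mulr_ge0 ?sqr_ge0 // divr_ge0.
- exact: Rm_ge.
Qed.

(** * Assembly of the four claims *)

Local Open Scope classical_set_scope.
Local Open Scope complex_scope.

Theorem theorem6 (R : realType) (n m : nat)
    (A : 'M[R]_n) (B : 'M[R]_(n, m)) (C : 'M[R]_(m, n)) (D : 'M[R]_m)
    (M_minimal : minimal (Model A B C D))
    (M_strictly_passive : strictly_passive (Model A B C D))
    (xi : R) (xi_gt0 : 0 < xi) (xi_ltXi : (xi%:E < Xi_sup (Model A B C D))%E)
    (nh : nat) (U V : 'M[R]_(n, nh)) (W : 'M[R]_(m, nh)) (Rxi : 'M[R]_nh)
    (UVW_basis : \rank (col_mx U (col_mx V W)) = nh)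
    (Rxi_spectrum : forall s : R[i], eigenvalue (cmx Rxi) s -> 0 < complex.Re s)
    (UVW_deflating : forall s : R,
       shifted_pencil (Model A B C D) xi s *m col_mx U (col_mx V W)
       = col_mx V (col_mx (- U) 0) *m (Rxi - s%:M)) :
  let X := - (U^T *m V) in
  let Ah := invmx (U^T *m V) *m (U^T *m A *m V) in
  let Bh := invmx (U^T *m V) *m (U^T *m B) in
  let Ch := C *m V in
  let Dh := D in
  let M := Model A B C D in
  let Mh := Model Ah Bh Ch Dh in
  [/\ [/\ \rank U = nh, \rank V = nh & pdmx X],
      [/\ tf_at_infty M D,
          tf_at_infty Mh D &
          forall (sigma : 'I_nh -> R[i]) (r : 'I_nh -> 'cV[R[i]]_nh),
            (forall j, eigenpair Rxi (sigma j) (r j)) ->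
            self_conjugate sigma r ->
            forall j,
              let sp := sigma j - (xi / 2)%:C in
              let sm := - sigma j - (xi / 2)%:C in
              [/\ regular_at M sp,
                  regular_at Mh sp,
                  tf M sp *m cmx W *m r j = tf Mh sp *m cmx W *m r j &
                  regular_at M sm -> regular_at Mh sm ->
                  (r j)^T *m (cmx W)^T *m tf M sm
                  = (r j)^T *m (cmx W)^T *m tf Mh sm]],
      psdmx (block_mx (- (X *m Ah) - Ah^T *m X) (Ch^T - X *m Bh)
                      (Ch - Bh^T *m X) (Dh^T + Dh)
             - xi *: block_mx X 0 0 1%:M)
      /\ pdmx (xi *: block_mx X 0 0 1%:M : 'M[R]_(nh + m)) &
      forall T : 'M[R]_nh, X = T^T *m T ->
        exists (J Rh : 'M[R]_nh) (G P : 'M[R]_(nh, m)) (N S : 'M[R]_m),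
          [/\ block_mx T 0 0 1%:M *m block_mx Ah Bh Ch Dh
                *m block_mx (invmx T) 0 0 1%:M
              = block_mx (J - Rh) (G - P) (G + P)^T (N + S),
              normalized_pH J Rh G P N S,
              ((xi / 2)%:E <= passivity_radius (@spectral_norm R _ _)
                 (Model (J - Rh) (G - P) (G + P)^T (N + S)))%E &
              ((xi / 2)%:E <= passivity_radius (@frobenius_norm R _ _)
                 (Model (J - Rh) (G - P) (G + P)^T (N + S)))%E]].
Proof.
move=> X Ah Bh Ch Dh M Mh.
have UVW := shifted_pencil_eqs UVW_deflating.
have [xi' xi_lt sp'] := Xi_sup_lt xi_ltXi.
have [ctrl _] := M_minimal.
have Xpd : pdmx X := gram_pd UVW Rxi_spectrum UVW_basis ctrl xi_lt sp'.
have Spd := Sxi_pd xi_lt sp'.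
have [rU rV] := rank_UV Xpd.
have UVu := gram_unit Xpd.
have lmi : psdmx (block_mx (- (X *m Ah) - Ah^T *m X) (Ch^T - X *m Bh)
    (Ch - Bh^T *m X) (Dh^T + Dh) - xi *: block_mx X 0 0 1%:M).
  by rewrite (lmi_gram UVW Xpd Spd); apply/psdmx_congr/pdmx_psd.
split.
- by [].
- split; [exact: tf_at_infty_mD | exact: tf_at_infty_mD |].
  move=> sigma r rP _ j sp sm; have [r0 Mr] := rP j.
  have sigma0 : 0 < complex.Re (sigma j).
    by apply: Rxi_spectrum; apply/eigenvalue_colP; exists (r j).
  have reg : regular_at M sp.
    rewrite /regular_at /=.
    have -> : sp%:M - cmx A = (sigma j)%:M - cmx (A + (xi / 2)%:M).
      by rewrite /sp cmxD cmx_scalar raddfB /= opprD addrA addrAC.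
    rewrite eigenvalue_unitmx; apply/negP => /(Axi_stable xi_lt sp').
    by rewrite ltNge ltW.
  have regh : regular_at Mh sp.
    rewrite /regular_at eigenvalue_unitmx; apply/negP => /(Ah_spec UVW Xpd Spd).
    by rewrite /sp raddfB /=; lra.
  split; [exact: reg | exact: regh | |].
    by apply: (right_interpolation UVW UVu Mr).
  (* The left points have real part below -xi/2, where poles of either model may lie; hence the two
     regularity premises. *)
  by apply: (left_interpolation UVW UVu Mr).
- by split=> //; apply/pdmxZ/pdmx_block_diag/pdmx1.
move=> T XT; have [J [Rh [G [P [N [S [e pH ge]]]]]]] :=
  lmi_normalized_pH Xpd XT (ltW xi_gt0) lmi.
exists J, Rh, G, P, N, S; split=> //.
  by apply: passivity_radius_ge pH ge _.
by apply: passivity_radius_ge pH ge _ => K; apply: spectral_norm_le.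
Qed.
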